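(* Let $K\subset\mathbb{R}^d$ be a bounded measurable set with positive Lebesgue measure. Let $\Lambda\subset\mathbb{R}^{2d}$ be a lattice of the form $$\Lambda=\begin{pmatrix} A & D\\ O & B\end{pmatrix}(\mathbb{Z}^{2d}),\qquad \mathrm{dens}(\Lambda)=1,$$ where $A,B,D$ are real $d\times d$ matrices such that $A^{-1}D$ is a symmetric rational matrix and $A^tB=I$. If $\mathcal{G}(|K|^{-1/2}\chi_K,\Lambda)$ is a Gabor orthonormal basis for $L^2(\mathbb{R}^d)$, then $K$ tiles $\mathbb{R}^d$ by translations and is a spectral set.
   Context: For $\Lambda=M(\mathbb{Z}^{2d})$ with $M$ invertible, $\mathrm{dens}(\Lambda)=|\det M|^{-1}$. $|K|$ denotes Lebesgue measure, $\chi_K$ the indicator function of $K$, $A^t$ the transpose of $A$, $I$ the $d\times d$ identity matrix. For $g\in L^2(\mathbb{R}^d)$ and a countable set $\Lambda\subset\mathbb{R}^{2d}$, the Gabor system $\mathcal{G}(g,\Lambda)$ is the collection of functions $\pi(a,b)g(x)=e^{2\pi i\langle b,x\rangle}g(x-a)$, $(a,b)\in\Lambda$ (with $a,b\in\mathbb{R}^d$); it is a Gabor orthonormal basis if it is an orthonormal basis of $L^2(\mathbb{R}^d)$. A set $K$ of positive finite measure is spectral if there is a countable set $\Gamma\subset\mathbb{R}^d$ such that $\{e^{2\pi i\langle\gamma,x\rangle}:\gamma\in\Gamma\}$ is an orthogonal basis of $L^2(K)$. $K$ tiles $\mathbb{R}^d$ by translations if there is a countable set $\mathcal{J}\subset\mathbb{R}^d$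 with $\sum_{t\in\mathcal{J}}\chi_K(x+t)=1$ for a.e. $x\in\mathbb{R}^d$. *)

(* Defs.v *)
From HB Require Import structures.
From mathcomp Require Import all_boot all_order all_algebra.
From mathcomp Require Import all_classical all_reals all_analysis.
From mathcomp Require Export complex.

Set Implicit Arguments.
Unset Strict Implicit.
Unset Printing Implicit Defensive.

Import Order.TTheory GRing.Theory Num.Theory.
Import numFieldNormedType.Exports.

Local Open Scope classical_set_scope.
Local Open Scope ring_scope.
Local Open Scope complex_scope.

Section borel_column_vectors.
Context (R : realType) (n : nat).

Definition vcoord (i : 'I_n) (v : 'cV[R]_n) : measurableTypeR R := v i ord0.

Let cV_set0 : g_sigma_preimage vcoord set0.
Proof. exact: sigma_algebra0. Qed.

Let cV_setC A : g_sigma_preimage vcoord A -> g_sigma_preimage vcoord (~` A).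
Proof. exact: sigma_algebraC. Qed.

Let cV_bigcup (F : (set 'cV[R]_n)^nat) :
  (forall i, g_sigma_preimage vcoord (F i)) ->
  g_sigma_preimage vcoord (\bigcup_i (F i)).
Proof. exact: sigma_algebra_bigcup. Qed.

Definition cV_display : measure_display.
Proof. exact: default_measure_display. Qed.

(* The Borel sigma-algebra of R^n, generated by the coordinates. *)
HB.instance Definition _ := @isMeasurable.Build cV_display
  'cV[R]_n (g_sigma_preimage vcoord) cV_set0 cV_setC cV_bigcup.

Lemma measurable_vcoord (i : 'I_n) : measurable_fun [set: 'cV[R]_n] (vcoord i).
Proof.
move=> _ Y mY; rewrite setTI; apply: sub_sigma_algebra => /=.
rewrite -bigcup_seq/=; exists i => /=; first by rewrite mem_index_enum.
by exists Y => //; rewrite setTI.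
Qed.

Lemma measurable_fun_vcoord d (T : measurableType d) (f : T -> 'cV[R]_n) :
  (forall i, measurable_fun [set: T] (vcoord i \o f)) ->
  measurable_fun [set: T] f.
Proof.
move=> mf _ Y mY; rewrite setTI.
suff : g_sigma_preimage (fun i => vcoord i \o f) `<=` measurable.
  rewrite g_sigma_preimage_comp; apply.
  by exists Y => //; rewrite setTI.
apply: smallest_sub; first exact: sigma_algebra_measurable.
rewrite -bigcup_seq/=; apply: bigcup_sub => i _ A [B mB <-].
exact: mf.
Qed.

End borel_column_vectors.

Section lebesgue_measure_vectors.
Context (R : realType).

Section cons.
Variable n : nat.

Definition cV_cons (p : measurableTypeR R * 'cV[R]_n) : 'cV[R]_n.+1 :=
  \col_i if unlift ord0 i is Some j then p.2 j ord0 else p.1.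

Definition cV_uncons (v : 'cV[R]_n.+1) : measurableTypeR R * 'cV[R]_n :=
  (v ord0 ord0, \col_j v (lift ord0 j) ord0).

Lemma cV_consK : cancel cV_cons cV_uncons.
Proof.
move=> [x v]; rewrite /cV_uncons !mxE unlift_none; congr pair.
by apply/colP => j; rewrite !mxE liftK.
Qed.

Lemma measurable_cV_cons : measurable_fun setT cV_cons.
Proof.
apply: measurable_fun_vcoord => i.
case: (unliftP ord0 i) => [j ->|->].
  rewrite (_ : _ \o _ = vcoord j \o snd); last first.
    by apply/funext => p; rewrite /= /vcoord mxE liftK.
  apply: measurableT_comp; first exact: measurable_vcoord.
  exact: measurable_snd.
rewrite (_ : _ \o _ = fst); first exact: measurable_fst.
by apply/funext => p; rewrite /= /vcoord mxE unlift_none.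
Qed.

Lemma measurable_cV_uncons : measurable_fun setT cV_uncons.
Proof.
apply/measurable_fun_pairP; split => /=.
  exact: (measurable_vcoord ord0).
apply: measurable_fun_vcoord => i.
rewrite (_ : _ \o _ = vcoord (lift ord0 i)); first exact: measurable_vcoord.
by apply/funext => p; rewrite /= /vcoord /= mxE.
Qed.

Variable mu : {sigma_finite_measure set 'cV[R]_n -> \bar R}.

Definition cons_measure : set 'cV[R]_n.+1 -> \bar R :=
  pushforward (lebesgue_measure \x mu)%E cV_cons.

Let cons_measure0 : cons_measure set0 = 0%E.
Proof. by rewrite /cons_measure /pushforward preimage_set0 measure0. Qed.

Let cons_measure_ge0 A : (0 <= cons_measure A)%E.
Proof. by rewrite /cons_measure /pushforward measure_ge0. Qed.

Let cons_measure_sigma_additive : semi_sigma_additive cons_measure.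
Proof.
move=> F mF tF mUF; rewrite /cons_measure /pushforward preimage_bigcup.
apply: measure_semi_sigma_additive.
- by move=> k; rewrite -[X in measurable X]setTI; exact: measurable_cV_cons.
- apply/trivIsetP => /= i j _ _ ij; rewrite -preimage_setI.
  by move/trivIsetP : tF => /(_ _ _ _ _ ij) ->//; rewrite preimage_set0.
- by rewrite -preimage_bigcup -[X in measurable X]setTI;
    exact: measurable_cV_cons.
Qed.

HB.instance Definition _ := isMeasure.Build _ _ _ cons_measure
  cons_measure0 cons_measure_ge0 cons_measure_sigma_additive.

Let cons_measure_sigma_finite : sigma_finite setT cons_measure.
Proof.
have /sigma_finiteP[F [TF ndF Foo]] := sigma_finiteT (@lebesgue_measure R).
have /sigma_finiteP[G [TG ndG Goo]] := sigma_finiteT mu.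
exists (fun k => cV_uncons @^-1` (F k `*` G k)).
  rewrite -preimage_bigcup -(preimage_setT cV_uncons); congr (_ @^-1` _).
  apply/seteqP; split=> // -[x v] _.
  have [i _ Fix] : (\bigcup_i F i) x by rewrite -TF.
  have [j _ Gjv] : (\bigcup_i G i) v by rewrite -TG.
  exists (maxn i j) => //; split => /=.
    by move: x Fix; exact/subsetPset/ndF/leq_maxl.
  by move: v Gjv; exact/subsetPset/ndG/leq_maxr.
move=> k; have [mF Fk] := Foo k; have [mG Gk] := Goo k; split.
  rewrite -[X in measurable X]setTI; apply: measurable_cV_uncons => //.
  exact: measurableX.
rewrite /cons_measure /pushforward -comp_preimage.
rewrite (_ : cV_uncons \o cV_cons = id); last first.
  by apply/funext => p /=; rewrite cV_consK.
rewrite preimage_id product_measure1E// lte_mul_pinfty// ge0_fin_numE//.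
Qed.

HB.instance Definition _ := @Measure_isSigmaFinite.Build _ _ _ cons_measure
  cons_measure_sigma_finite.

End cons.

(* The n-fold product of the Lebesgue measure of R, on the Borel sets of R^n. *)
Fixpoint borel_lebesgue (n : nat) :
    {sigma_finite_measure set 'cV[R]_n -> \bar R} :=
  match n return {sigma_finite_measure set 'cV[R]_n -> \bar R} with
  | 0 => \d_(0 : 'cV[R]_0)
  | m.+1 => cons_measure (borel_lebesgue m)
  end.

End lebesgue_measure_vectors.

(* R^n with the Lebesgue sigma-algebra, i.e. the completion of the Borel
   sigma-algebra obtained by Caratheodory's construction. *)
Definition lebesgue_space (R : realType) (n : nat) :=
  caratheodory_type (borel_lebesgue R n)^*%mu.

Definition lebesgue (R : realType) (n : nat) :
  set (lebesgue_space R n) -> \bar R :=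
  @completed_measure_extension _ _ _ (borel_lebesgue R n).

HB.instance Definition _ (R : realType) (n : nat) :=
  Measure.on (@lebesgue R n).

Arguments lebesgue {R n}.

Definition lebesgue_measurable (R : realType) (n : nat) (K : set 'cV[R]_n) :
  Prop := measurable (K : set (lebesgue_space R n)).

Section complex_functions.
Context (R : realType) (n : nat).
Implicit Types (D : set 'cV[R]_n) (f g : 'cV[R]_n -> R[i]).

Definition cintegral D f : R[i] :=
  (\int[lebesgue]_(x in D) complex.Re (f x))%R +i*
  (\int[lebesgue]_(x in D) complex.Im (f x))%R.

Definition sqnorm D f : \bar R :=
  (\int[lebesgue]_(x in D) (Normc.normc (f x) ^+ 2)%:E)%E.

Definition inner D f g : R[i] := cintegral D (fun x => f x * (g x)^*).

Definition cmeasurable D f : Prop :=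
  measurable_fun (D : set (lebesgue_space R n)) (fun x => complex.Re (f x)) /\
  measurable_fun (D : set (lebesgue_space R n)) (fun x => complex.Im (f x)).

(* Elements of L^2(D) are represented by functions on R^n, of which only the
   restriction to D matters; they are not quotiented by a.e. equality. *)
Definition L2 D f : Prop := cmeasurable D f /\ (sqnorm D f < +oo)%E.

(* The family (e i) indexed by i in I has dense linear span in L^2(D). *)
Definition span_dense (T : eqType) (I : set T) D (e : T -> 'cV[R]_n -> R[i]) :
  Prop :=
  forall f, L2 D f -> forall eps : R, 0 < eps ->
  exists (s : seq T) (c : T -> R[i]), [set` s] `<=` I /\
    (sqnorm D (fun x => (f x - \sum_(i <- s) c i * e i x)%R) < eps%:E)%E.

Definition orthogonal_basis (T : eqType) (I : set T) D
    (e : T -> 'cV[R]_n -> R[i]) : Prop :=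
  [/\ forall i, I i -> L2 D (e i) /\ inner D (e i) (e i) != 0,
      forall i j, I i -> I j -> i != j -> inner D (e i) (e j) = 0 &
      span_dense I D e].

Definition orthonormal_basis (T : eqType) (I : set T) D
    (e : T -> 'cV[R]_n -> R[i]) : Prop :=
  orthogonal_basis I D e /\ forall i, I i -> inner D (e i) (e i) = 1.

End complex_functions.

Section gabor.
Context (R : realType) (d : nat).
Implicit Types (K : set 'cV[R]_d) (g : 'cV[R]_d -> R[i]).

Definition dotv (u v : 'cV[R]_d) : R := \sum_i u i ord0 * v i ord0.

(* x |-> e^{2 pi i <b, x>} *)
Definition character (b x : 'cV[R]_d) : R[i] :=
  cos (2 * pi * dotv b x) +i* sin (2 * pi * dotv b x).

(* A point of R^{2d} is a pair (a, b), with a = usubmx w and b = dsubmx w. *)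
Definition tf_shift (w : 'cV[R]_(d + d)) g (x : 'cV[R]_d) : R[i] :=
  character (dsubmx w) x * g (x - usubmx w).

Definition gabor_orthonormal_basis g (Lambda : set 'cV[R]_(d + d)) : Prop :=
  orthonormal_basis Lambda setT (fun w => tf_shift w g).

(* |K|^{-1/2} chi_K *)
Definition normalized_indicator K (x : 'cV[R]_d) : R[i] :=
  ((Num.sqrt (fine (lebesgue K)))^-1 * \1_K x)%:C.

Definition spectral K : Prop :=
  [/\ lebesgue_measurable K, (0 < lebesgue K < +oo)%E &
      exists Gamma : set 'cV[R]_d,
        countable Gamma /\ orthogonal_basis Gamma K character].

Definition tiles K : Prop :=
  exists J : set 'cV[R]_d, countable J /\
    {ae lebesgue, forall x : 'cV[R]_d,
      (\esum_(t in J) (\1_K (x + t)%R : R)%:E = 1)%E}.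

End gabor.

(* The set M(Z^n), a lattice when M is invertible. *)
Definition lattice (R : realType) (n : nat) (M : 'M[R]_n) : set 'cV[R]_n :=
  range (fun z : 'cV[int]_n => M *m map_mx intr z).

Definition dens (R : realType) (n : nat) (M : 'M[R]_n) : R := `|\det M|^-1.

Definition rational_mx (R : realType) (m n : nat) (A : 'M[R]_(m, n)) : Prop :=
  exists Q : 'M[rat]_(m, n), A = map_mx ratr Q.

(* Main.v *)
Require Import Defs.
From HB Require Import structures.
From mathcomp Require Import all_boot all_order all_algebra.
From mathcomp Require Import all_classical all_reals all_analysis.
From mathcomp Require Import measurable_realfun lra ring zify.

(* The first components of the points of Lambda form a lattice T, and since A^-1 D
   is symmetric and rational, Lambda contains {0} x T*, where T* is the dual lattice
   of T (both are described by one matrix H coming from a Smith normal form: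
   T = H^-1 Z^d and T* = H^T Z^d).  Orthogonality says that for distinct a, a' in T
   there is beta such that all the integrals of e^{2 pi i <beta + n, x>}, n in T*,
   over (K + a) /\ (K + a') vanish.  If a set F meets its translates by T \ {0} in
   null sets only, the vanishing of these integrals over F forces |F| = 0, by
   uniqueness of Fourier coefficients on R^d / T.  The sets (K + a) /\ (K + a') of
   positive measure with a' - a longest have this packing property, because for
   every s either t + s or t - s is longer than t; hence there are none and K packs
   by T.  Completeness of the Gabor system then gives the rest: a function supported
   off K + T is orthogonal to the whole system, so K tiles by T, and on K the only
   surviving elements of the system are the characters with frequencies b such that
   (0, b) is in Lambda. *)

Set Implicit Arguments.
Unset Strict Implicit.
Unset Printing Implicit Defensive.

Import Order.TTheory GRing.Theory Num.Theory.
Import numFieldNormedType.Exports.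

Local Open Scope classical_set_scope.
Local Open Scope ring_scope.

(** * Arcs of the circle through cosines, and powers that converge to indicators *)

Section trigonometry.
Variable R : realType.
Implicit Types (x a c u : R).

Lemma cosDint x (m : int) : cos (x + 2 * pi * m%:~R) = cos x.
Proof.
have Hn (n : nat) y : cos (y + 2 * pi * n%:R) = cos y.
  elim: n y => [|n IHn] y; first by rewrite mulr0 addr0.
  rewrite (_ : y + _ = y + 2 * pi * n%:R + pi *+ 2) ?cosD2pi ?IHn//.
  by rewrite -natr1; ring.
case: m => n; first exact: Hn.
rewrite NegzE -[in RHS](subrK (2 * pi * n.+1%:R) x) Hn.
by rewrite rmorphN /= mulrN.
Qed.

Lemma cosMcos x a : cos x * cos a = (cos (x + a) + cos (x - a)) / 2.
Proof. by rewrite cosD cosB; field. Qed.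

Definition frac x := x - (Num.floor x)%:~R.

Lemma frac_itv x : 0 <= frac x < 1.
Proof.
rewrite /frac subr_ge0 floor_le_tmp/= ltrBlDr.
by have := floorD1_gt x; rewrite rmorphD/= addrC.
Qed.

Lemma measurable_frac : measurable_fun setT frac.
Proof.
apply: measurable_funB => //; apply: nondecreasing_measurable => //.
by move=> x y xy; rewrite ler_int le_floor.
Qed.

(** The arc from 0 to c on the circle of length 1 is centred at c / 2; the cosine of 2 pi (x - c /
    2) decreases with the distance to the centre and equals cos (pi c) at both ends. *)
Lemma frac_le_cos x c : 0 <= c < 1 ->
  (frac x <= c) = (cos (pi * c) <= cos (2 * pi * x - pi * c)).
Proof.
move=> /andP[c0 c1]; have pi0 := pi_gt0 R.
have /andP[y0 y1] := frac_itv x.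
have I (z : R) : 0 <= z <= 1 -> pi * z \in `[0, pi].
  move=> /andP[z0 z1]; rewrite in_itv/=; apply/andP; split.
    by apply: mulr_ge0 => //; exact: ltW.
  by rewrite ger_pMr.
have -> : cos (2 * pi * x - pi * c) = cos (pi * `|2 * frac x - c|).
  rewrite -[pi in RHS]ger0_norm ?ltW// -normrM cos_norm.
  rewrite -[LHS](cosDint _ (- Num.floor x)) /frac rmorphN/=.
  by congr cos; ring.
have [yc|yc] := leP (2 * frac x - c) 1; last first.
  have yy : frac x = c + (frac x - c) by ring.
  rewrite ger0_norm; last by lra.
  (* Beyond the antipode of the centre the angle exceeds pi; it is reflected into [0, pi], where cos
     is decreasing. *)
  have -> : cos (pi * (2 * frac x - c)) = cos (pi * (2 + c - 2 * frac x)).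
    by rewrite -[LHS](cosDint _ (-1)) -cosN mulrN1z; congr cos; ring.
  rewrite [RHS]leNgt ltr_cos ?I ?(ltW c1) ?c0//; last by apply/andP; split; lra.
  by rewrite ltr_pM2l// -leNgt; apply/idP/idP; lra.
rewrite [RHS]leNgt ltr_cos ?I ?(ltW c1) ?c0//; last first.
  by rewrite normr_ge0 ler_norml; apply/andP; split; lra.
by rewrite ltr_pM2l// -leNgt ler_norml; apply/idP/andP => [|[]]; [split; lra|lra].
Qed.

Lemma bernoulli_le x n : 0 <= x <= 1 -> 1 - n%:R * x <= (1 - x) ^+ n.
Proof.
move=> /andP[x0 x1]; elim: n => [|n IHn]; first by rewrite expr0 mul0r subr0.
rewrite exprS -natr1.
have : (1 - x) * (1 - n%:R * x) <= (1 - x) * (1 - x) ^+ n.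
  by rewrite ler_wpM2l// subr_ge0.
apply: le_trans; rewrite -subr_ge0 (_ : _ - _ = n%:R * x ^+ 2); last by ring.
by rewrite mulr_ge0// sqr_ge0.
Qed.

Lemma bernoulli_ge x n : 0 <= x <= 1 -> (1 - x) ^+ n * (1 + n%:R * x) <= 1.
Proof.
move=> /andP[x0 x1]; elim: n => [|n IHn].
  by rewrite expr0 mul0r addr0 mulr1.
apply: le_trans IHn; rewrite exprSr -mulrA ler_wpM2l ?exprn_ge0 ?subr_ge0//.
rewrite -natr1 -subr_ge0 (_ : _ - _ = n.+1%:R * x ^+ 2).
  by rewrite mulr_ge0// sqr_ge0.
by rewrite -natr1; ring.
Qed.

(** The n + 1 terms of 1 + x + ... + x^n are all at least x^n, and 1 - x times that sum is the
    right-hand side. *)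
Lemma natM_geometric_le x n : 0 <= x <= 1 ->
  n.+1%:R * x ^+ n * (1 - x) <= 1 - x ^+ n.+1.
Proof.
move=> /andP[x0 x1]; elim: n => [|n IHn]; first by rewrite expr0 expr1 !mul1r.
have xn : x ^+ n.+1 <= 1 by rewrite exprn_ile1.
have := ler_wpM2l x0 IHn.
rewrite (_ : x * _ = n.+1%:R * x ^+ n.+1 * (1 - x)); last by rewrite exprS; ring.
rewrite -[n.+2%:R]natr1 (exprS x n.+1) => h.
have : 0 <= (1 - x) * (1 - x ^+ n.+1) by rewrite mulr_ge0// subr_ge0.
nra.
Qed.

Lemma cvg_natM_geometric x : 0 <= x < 1 ->
  (fun n : nat => n.+1%:R * x ^+ n : R) @ \oo --> (0 : R).
Proof.
move=> /andP[x0 x1]; have x1' : 0 < 1 - x by rewrite subr_gt0.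
(* Half of the decay absorbs the linear factor: x^n = y^n y^n, where (n + 1) y^n is at most 1 / (1 -
   y) and the other y^n tends to 0. *)
pose y := Num.sqrt x.
have y0 : 0 <= y by exact: sqrtr_ge0.
have y1 : y < 1 by rewrite -sqrtr1 ltr_sqrt.
have y1' : 0 < 1 - y by rewrite subr_gt0.
have xE : x = y ^+ 2 by rewrite sqr_sqrtr.
apply: (@squeeze_cvgr _ _ _ _ (cst 0) (fun n : nat => (1 - y)^-1 * y ^+ n)).
- apply: nearW => n /=; rewrite mulr_ge0 ?exprn_ge0//=.
  rewrite xE -exprM mul2n -addnn exprD mulrA ler_wpM2r ?exprn_ge0//.
  rewrite -(ler_pM2r y1') mulVf ?gt_eqF//.
  apply: (@le_trans _ _ (1 - y ^+ n.+1)).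
    by apply: natM_geometric_le; rewrite y0 ltW.
  by rewrite gerBl exprn_ge0.
- exact: cvg_cst.
- rewrite -[X in _ --> X](mulr0 (1 - y)^-1); apply: cvgMr; apply: cvg_expr.
  by rewrite ger0_norm.
Qed.

(** Let M be the exponent, which exceeds k / c^k. If u < c, then M u^k is at most (k + 1) (u / c)^k,
    which tends to 0, and Bernoulli's inequality pushes the power to 1. If c <= u, then M u^k is at
    least k and the power is at most 1 / (k + 1). *)
Lemma cvg_pow_indic u c : 0 <= u <= 1 -> 0 < c <= 1 ->
  (fun k : nat => (1 - u ^+ k) ^+ (Num.truncn (k%:R / c ^+ k)).+1 : R) @ \oo -->
  ((u < c)%R%:R : R).
Proof.
move=> /andP[u0 u1] /andP[c0 c1].
have uk k : 0 <= u ^+ k <= 1 by rewrite exprn_ge0//= exprn_ile1.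
have ck k : 0 < c ^+ k by rewrite exprn_gt0.
have [uc|cu] := ltP u c.
- have r01 : 0 <= u / c < 1 by rewrite divr_ge0// ?(ltW c0)//= ltr_pdivrMr// mul1r.
  apply: (@squeeze_cvgr _ _ _ _ (fun k : nat => 1 - k.+1%:R * (u / c) ^+ k) (cst 1)).
  + apply: nearW => k; apply/andP; split; last first.
      by rewrite exprn_ile1 ?subr_ge0 ?gerBl//; case/andP: (uk k).
    apply: le_trans (bernoulli_le _ (uk k)); rewrite lerB//.
    have -> : u ^+ k = (u / c) ^+ k * c ^+ k by rewrite -exprMn divfK// gt_eqF.
    rewrite mulrCA [leRHS]mulrC ler_wpM2l ?exprn_ge0//; first by case/andP: r01.
    rewrite -2!natr1 mulrDl mul1r lerD// ?exprn_ile1// ?(ltW c0)//.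
    by rewrite -ler_pdivlMr// truncn_le divr_ge0// ltW.
  + rewrite -[X in _ --> X]subr0; apply: cvgB; first exact: cvg_cst.
    exact: cvg_natM_geometric.
  + exact: cvg_cst.
- apply: (@squeeze_cvgr _ _ _ _ (cst 0) harmonic).
  + apply: nearW => k; rewrite /= exprn_ge0 ?subr_ge0//=; last by case/andP: (uk k).
    rewrite /harmonic/= -[leRHS]div1r ler_pdivlMr//.
    apply: le_trans (bernoulli_ge (Num.truncn (k%:R / c ^+ k)).+1 (uk k)).
    apply: ler_wpM2l; first by rewrite exprn_ge0 ?subr_ge0//; case/andP: (uk k).
    rewrite -nat1r lerD2l (le_trans _ (ler_wpM2l _ (_ : c ^+ k <= u ^+ k)))//.
      by rewrite -ler_pdivrMr// ltW// truncnS_gt.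
    by rewrite lerXn2r// nnegrE// ltW.
  + exact: cvg_cst.
  + exact: cvg_harmonic.
Qed.
End trigonometry.

(** * Weights whose Fourier coefficients on F vanish *)

Section annihilation.
Context d (T : measurableType d) (R : realType) (mu : {measure set T -> \bar R}).
Variables (F : set T) (mF : measurable F) (Ffin : (mu F < +oo)%E).
Variables (theta : T -> R) (mtheta : measurable_fun setT theta).
Variables (n : nat) (h : 'I_n -> T -> R).
Hypothesis mh : forall i, measurable_fun setT (h i).
Implicit Types (w : T -> R) (z : 'I_n -> int) (g : R).

(** With a free shift g, cosines alone carry both the real and the imaginary part of e^{2 pi i
    (theta + sum z_i h_i)}. *)
Definition phase z g x : R :=
  2 * pi * (theta x + \sum_i (z i)%:~R * h i x) + g.

Definition bounded_measurable w :=
  measurable_fun setT w /\ exists M, forall x, `|w x| <= M.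

(** Equivalently, the push-forward to the torus, under h, of w e^{2 pi i theta} dmu on F has zero
    Fourier coefficients. The class of such w is enlarged below from the constant 1 to
    indicators. *)
Definition annihilates w := bounded_measurable w /\
  forall z g, \int[mu]_(x in F) (w x * cos (phase z g x)) = 0.

Lemma measurable_phase z g : measurable_fun setT (phase z g).
Proof.
apply: measurable_funD => //; apply: measurable_funM => //.
apply: measurable_funD => //.
by apply: measurable_sum => i; exact: measurable_funM.
Qed.

Lemma measurable_cos_phase z g : measurable_fun setT (cos \o phase z g).
Proof.
apply: measurableT_comp (measurable_phase z g).
exact: continuous_measurable_fun (@continuous_cos R).
Qed.

Lemma integrable_phase w z g : bounded_measurable w ->
  mu.-integrable F (EFin \o (fun x => w x * cos (phase z g x))).
Proof.
move=> [mw [M wM]]; apply: measurable_bounded_integrable => //.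
  apply: measurable_funTS.
  by apply: measurable_funM => //; exact: measurable_cos_phase.
exists M; split; first by rewrite num_real.
move=> y My x _ /=; rewrite (le_trans _ (ltW My))// normrM.
by rewrite (le_trans _ (wM x))// ler_piMr// cos_max.
Qed.

Lemma bounded_measurableM w v : bounded_measurable w -> bounded_measurable v ->
  bounded_measurable (w \* v).
Proof.
move=> [mw [M wM]] [mv [N vN]]; split; first exact: measurable_funM.
exists (M * N) => x /=; rewrite normrM ler_pM//.
Qed.

Lemma bounded_measurableD w v : bounded_measurable w -> bounded_measurable v ->
  bounded_measurable (w \+ v).
Proof.
move=> [mw [M wM]] [mv [N vN]]; split; first exact: measurable_funD.
by exists (M + N) => x /=; rewrite (le_trans (ler_normD _ _))// lerD.
Qed.

Lemma bounded_measurable_cst a : bounded_measurable (cst a).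
Proof. by split => //; exists `|a|. Qed.

Lemma annihilatesD w v : annihilates w -> annihilates v -> annihilates (w \+ v).
Proof.
move=> [bw Hw] [bv Hv]; split; first exact: bounded_measurableD.
move=> z g; under eq_Rintegral do rewrite mulrDl.
by rewrite RintegralD ?Hw ?Hv ?addr0//; exact: integrable_phase.
Qed.

Lemma annihilatesZ w a : annihilates w -> annihilates (fun x => w x * a).
Proof.
move=> [bw Hw]; split.
  exact: (bounded_measurableM bw (bounded_measurable_cst a)).
move=> z g; under eq_Rintegral do rewrite mulrAC.
by rewrite RintegralZr ?Hw ?mul0r//; exact: integrable_phase.
Qed.

Lemma annihilates_eq w v : w =1 v -> annihilates w -> annihilates v.
Proof. by move=> /funext->. Qed.

Lemma annihilates_eq_on w v : bounded_measurable v ->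
  (forall x, F x -> w x = v x) -> annihilates w -> annihilates v.
Proof.
move=> bv wv [_ Hw]; split=> // z g; rewrite -[RHS](Hw z g).
by apply: eq_Rintegral => x /set_mem Fx; rewrite wv.
Qed.

Lemma annihilatesB w v : annihilates w -> annihilates v ->
  annihilates (fun x => w x - v x).
Proof.
move=> Hw /(annihilatesZ (-1)) Hv.
by apply: annihilates_eq (annihilatesD Hw Hv) => x /=; rewrite mulrN1.
Qed.

Lemma phaseD z i (b : int) g a x :
  phase z g x + (2 * pi * (b%:~R * h i x) + a) =
  phase (fun j => z j + b *+ (j == i)) (g + a) x.
Proof.
rewrite /phase; under [in RHS]eq_bigr do rewrite rmorphD/= mulrDl.
rewrite big_split/= (_ : \sum_j (b *+ (j == i))%:~R * h j x = b%:~R * h i x).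
  by ring.
rewrite (bigD1 i)//= eqxx mulr1n big1 ?addr0// => j /negbTE ->.
by rewrite mulr0n mul0r.
Qed.

(** By the product-to-sum formula the new factor moves the i-th frequency by 1 or -1 and changes the
    shift, and both are arbitrary in [annihilates]. *)
Lemma annihilates_cos w i a : annihilates w ->
  annihilates (fun x => w x * cos (2 * pi * h i x + a)).
Proof.
move=> [bw Hw]; split.
  apply: (bounded_measurableM bw); split; last first.
    by exists 1 => x; exact: cos_max.
  apply: (@measurableT_comp _ _ _ _ _ _ cos).
    exact: continuous_measurable_fun (@continuous_cos R).
  by apply: measurable_funD => //; exact: measurable_funM.
move=> z g.
pose z1 (b : int) j := z j + b *+ (j == i).
have E x : w x * cos (2 * pi * h i x + a) * cos (phase z g x) =
    (w x * cos (phase (z1 1) (g + a) x) +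
     w x * cos (phase (z1 (-1)) (g - a) x)) * 2^-1.
  rewrite -!phaseD -mulrA [X in _ * X]mulrC cosMcos mulrN1z mulr1z mul1r.
  rewrite -mulrDr -[RHS]mulrA; congr (_ * ((cos _ + cos _) / 2)); ring.
under eq_Rintegral do rewrite E.
rewrite RintegralZr//; last first.
  exact: (integrableD mF (integrable_phase _ _ bw) (integrable_phase _ _ bw)).
by rewrite RintegralD ?Hw ?addr0 ?mul0r//; exact: integrable_phase.
Qed.

(** Dominated convergence, the constant M being integrable on F. *)
Lemma annihilates_lim (w_ : nat -> T -> R) w M :
  (forall k, annihilates (w_ k)) -> (forall k x, `|w_ k x| <= M) ->
  (forall x, (w_ ^~ x) @ \oo --> w x) -> annihilates w.
Proof.
move=> Hw wM ww; have bw : bounded_measurable w.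
  split.
    by apply: (measurable_fun_cvg (h := w_)) => // k; have [[]] := Hw k.
  exists M => x; apply: (cvgr_to_le (cvg_norm (ww x))).
  by apply: nearW => k; exact: wM.
split=> // z g.
have := @dominated_cvg _ _ _ mu F mF
  (fun k x => (w_ k x * cos (phase z g x))%:E)
  (fun x => (w x * cos (phase z g x))%:E) (cst M%:E).
rewrite /Rintegral => H.
have {}H : (fun k => \int[mu]_(x in F) (w_ k x * cos (phase z g x))%:E)%E @ \oo
    --> (\int[mu]_(x in F) (w x * cos (phase z g x))%:E)%E.
  apply: H => //.
  - move=> k; apply/measurable_EFinP/measurable_funTS.
    apply: measurable_funM; first by have [[]] := Hw k.
    exact: measurable_cos_phase.
  - move=> x _; apply: cvg_EFin; first exact: nearW.
    by apply: cvgMl; exact: ww.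
  - apply: measurable_bounded_integrable => //.
    exists `|M|; split; first by rewrite num_real.
    by move=> y My x _ /=; exact: ltW.
  - move=> k x _ /=; rewrite lee_fin normrM (le_trans _ (wM k x))//.
    by rewrite ler_piMr// cos_max.
rewrite (_ : (fun k => _) = cst 0%E) in H.
  by rewrite -(cvg_unique _ (@cvg_cst _ _ _ _ _) H).
apply/funext => k; rewrite -[LHS]fineK; last first.
  by apply: integrable_fin_num => //; apply: integrable_phase; case: (Hw k).
by have [_ /(_ z g)] := Hw k; rewrite /Rintegral => ->.
Qed.

(* The arc [frac (h i x) <= c] is [v <= u x] for u := (1 + cos (2 pi h i x - pi c)) / 2,
   and its indicator is the limit of 1 - (1 - u^k)^M with M about k / v^k; products
   with u only shift the phases, so they preserve annihilation. *)
Lemma annihilates_frac_le w i c : annihilates w ->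
  annihilates (fun x => w x * (frac (h i x) <= c)%R%:R).
Proof.
move=> Hw; have [c0|c0] := ltP c 0.
  apply: annihilates_eq (annihilatesZ 0 Hw) => x; congr (_ * _).
  have /andP[y0 _] := frac_itv (h i x).
  by rewrite leNgt (lt_le_trans c0 y0).
have [c1|c1] := leP 1 c.
  apply: annihilates_eq Hw => x; have /andP[_ y1] := frac_itv (h i x).
  by rewrite (le_trans (ltW y1) c1) mulr1.
pose u x := (1 + cos (2 * pi * h i x - pi * c)) / 2.
pose v := (1 + cos (pi * c)) / 2.
have mulu f : annihilates f -> annihilates (fun x => f x * u x).
  move=> Hf; apply: annihilates_eq (annihilatesZ 2^-1 (annihilatesD Hf
    (annihilates_cos i (- (pi * c)) Hf))) => x /=.
  by rewrite /u; ring.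
have mul1u f k : annihilates f -> annihilates (fun x => f x * (1 - u x ^+ k)).
  move=> Hf; have Hk : annihilates (fun x => f x * u x ^+ k).
    elim: k => [|k IHk].
      by apply: annihilates_eq Hf => x; rewrite expr0 mulr1.
    by apply: annihilates_eq (mulu _ IHk) => x; rewrite exprSr mulrA.
  by apply: annihilates_eq (annihilatesB Hf Hk) => x; rewrite mulrBr mulr1.
have mulX f k M : annihilates f ->
    annihilates (fun x => f x * (1 - u x ^+ k) ^+ M).
  move=> Hf; elim: M => [|M IHM].
    by apply: annihilates_eq Hf => x; rewrite expr0 mulr1.
  by apply: annihilates_eq (mul1u _ k IHM) => x; rewrite exprSr mulrA.
have u01 x : 0 <= u x <= 1.
  have := cos_le1 (2 * pi * h i x - pi * c).
  have := cos_geN1 (2 * pi * h i x - pi * c).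
  by rewrite /u => ? ?; apply/andP; split; lra.
have v01 : 0 < v <= 1.
  have := cos_le1 (pi * c); rewrite /v => ?; apply/andP; split; last by lra.
  suff : -1 < cos (pi * c) by lra.
  rewrite -cospi ltr_cos ?in_itv/= ?pi_ge0 ?lexx//.
    by rewrite gtr_pMr// pi_gt0.
  by rewrite mulr_ge0 ?pi_ge0// ger_pMr ?pi_gt0// ltW.
have [_ [M wM]] := Hw.1.
have : annihilates (fun x => w x * (u x < v)%R%:R).
  apply: (@annihilates_lim (fun k x =>
    w x * (1 - u x ^+ k) ^+ (Num.truncn (k%:R / v ^+ k)).+1) _ M).
  - by move=> k; exact: mulX.
  - move=> k x; rewrite normrM (le_trans _ (wM x))// ler_piMr//.
    have /andP[? ?] : 0 <= u x ^+ k <= 1.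
      by have /andP[? ?] := u01 x; rewrite exprn_ge0//= exprn_ile1.
    by rewrite ger0_norm ?exprn_ge0 ?exprn_ile1 ?subr_ge0// gerBl.
  - by move=> x; apply: cvgMr; exact: cvg_pow_indic.
move=> /(annihilatesB Hw); apply: annihilates_eq => x.
rewrite frac_le_cos ?c0//.
rewrite (_ : (u x < v) = ~~ (cos (pi * c) <= cos (2 * pi * h i x - pi * c))).
  by case: leP => _ /=; ring.
by rewrite -ltNge /u /v ltr_pM2r// ltrD2l.
Qed.

Lemma annihilates_box (c : 'I_n -> R) : annihilates (cst 1) ->
  annihilates \1_[set x | forall i, frac (h i x) <= c i].
Proof.
move=> H1.
have H (s : seq 'I_n) :
    annihilates (fun x => \prod_(i <- s) (frac (h i x) <= c i)%R%:R).
  elim: s => [|i s IHs].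
    by apply: annihilates_eq H1 => x; rewrite big_nil.
  apply: annihilates_eq (annihilates_frac_le i (c i) IHs) => x.
  by rewrite big_cons mulrC.
apply: annihilates_eq (H (enum 'I_n)) => x; rewrite big_enum/= indicE.
have [/set_mem/= Hx|Hx] := boolP (_ \in _).
  by rewrite big1// => i _; rewrite Hx.
have [i Hi] : exists i, ~~ (frac (h i x) <= c i).
  apply/not_existsP => nHi; move: Hx => /negP; apply; apply/mem_set => /= i.
  by apply: contrapT => /negP; exact: nHi.
by rewrite (bigD1 i)//= (negbTE Hi) mul0r.
Qed.

End annihilation.

(** * Borel sets of column vectors: a generator and some measurable maps *)

Section borel_vectors.
Context (R : realType) (n : nat).

(** Lower orthants are stable under intersection, as Dynkin's argument requires of a generator. *)
Definition boxes : set (set 'cV[R]_n) :=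
  [set B | exists c : 'I_n -> R, B = [set v : 'cV[R]_n | forall i, v i ord0 <= c i]].

Lemma setI_closed_boxes : setI_closed boxes.
Proof.
move=> _ _ [a ->] [b ->]; exists (fun i => Num.min (a i) (b i)).
apply/seteqP; split=> v /=.
  by move=> [va vb] i; rewrite le_min va vb.
by move=> vab; split=> i; have := vab i; rewrite le_min => /andP[].
Qed.

Lemma measurable_coord_le (c : R) (i : 'I_n) :
  measurable [set v : 'cV[R]_n | v i ord0 <= c].
Proof.
rewrite -[X in measurable X]setTI.
have := @measurable_vcoord R n i measurableT `]-oo, c]%classic (measurable_itv _).
by congr (measurable (_ `&` _)); apply/seteqP; split => v; rewrite /= in_itv.
Qed.

Lemma measurable_boxes : @measurable _ 'cV[R]_n = <<s boxes >>.
Proof.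
apply/seteqP; split; last first.
  apply: smallest_sub; first exact: sigma_algebra_measurable.
  move=> _ [c ->].
  rewrite (_ : mkset _ = \bigcap_(i : 'I_n) [set v : 'cV[R]_n | v i ord0 <= c i]).
    apply: fin_bigcap_measurable => // i _; exact: measurable_coord_le.
  by apply/seteqP; split => [v vc i _|v vc i]; exact: vc.
suff vm (i : 'I_n) : measurable_fun [set: g_sigma_algebraType boxes]
    (fun v : g_sigma_algebraType boxes => (v : 'cV[R]_n) i ord0).
  apply: smallest_sub; first exact: smallest_sigma_algebra.
  rewrite -bigcup_seq => A [i _] [Y mY <-].
  exact: (vm i measurableT Y mY).
apply: (measurability _ (RGenOInfty.measurableE R)).
move=> _ [_ [x ->] <-]; rewrite setTI.
(* The half-space v_i <= x is the union over k of the orthants whose other coordinates are at most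
   k. *)
rewrite (_ : _ @^-1` _ = ~` (\bigcup_k [set v : 'cV[R]_n |
  forall j, v j ord0 <= if j == i then x else k%:R])).
  apply: measurableC; apply: bigcupT_measurable => k.
  by apply: sub_sigma_algebra; eexists.
apply/seteqP; split => v /=; rewrite in_itv/= andbT.
  by move=> xv [k _ /(_ i)]; rewrite eqxx leNgt xv.
apply: contra_notT; rewrite -leNgt => vx.
exists (\max_(j < n) (Num.truncn (v j ord0)).+1)%N => // j.
case: eqP => [->//|_]; rewrite (le_trans (ltW (truncnS_gt _)))// ler_nat.
exact: (leq_bigmax j).
Qed.

Lemma measurable_mulmx_cV m (H : 'M[R]_(m, n)) :
  measurable_fun setT (fun v : 'cV[R]_n => H *m v).
Proof.
apply: measurable_fun_vcoord => i.
rewrite (_ : _ \o _ = fun v => \sum_j H i j * vcoord j v); last first.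
  by apply/funext => v; rewrite /= /vcoord mxE.
apply: measurable_sum => j; apply: measurable_funM => //.
exact: measurable_vcoord.
Qed.

Lemma measurable_shift_cV (a : 'cV[R]_n) :
  measurable_fun setT (fun v : 'cV[R]_n => v + a).
Proof.
apply: measurable_fun_vcoord => i.
rewrite (_ : _ \o _ = fun v => vcoord i v + a i ord0); last first.
  by apply/funext => v; rewrite /= /vcoord mxE.
by apply: measurable_funD => //; exact: measurable_vcoord.
Qed.

Lemma measurable_dotv (b : 'cV[R]_n) : measurable_fun setT (dotv b).
Proof.
by apply: measurable_sum => i; apply: measurable_funM => //;
  exact: measurable_vcoord.
Qed.

End borel_vectors.

(** * From boxes to all Borel sets *)

Section annihilates_borel.
Context d (T : measurableType d) (R : realType) (mu : {measure set T -> \bar R}).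
Variables (F : set T) (mF : measurable F) (Ffin : (mu F < +oo)%E).
Variables (theta : T -> R) (mtheta : measurable_fun setT theta).
Variables (n : nat) (h : 'I_n -> T -> R).
Hypothesis mh : forall i, measurable_fun setT (h i).
Local Notation annihilates := (annihilates mu F theta h).

(** Dynkin induction on Z: orthants pull back to boxes, complements are differences from 1, and
    disjoint unions are limits of partial sums bounded by 1. *)
Lemma annihilates_frac_preimage (Z : set 'cV[R]_n) : measurable Z ->
  annihilates (cst 1) ->
  annihilates \1_((fun x => \col_i frac (h i x)) @^-1` Z).
Proof.
move=> + H1; set r := fun x => _; rewrite measurable_boxes.
have H0 : annihilates (cst 0).
  by apply: annihilates_eq (annihilatesZ mF Ffin mtheta mh 0 H1) => x /=; rewrite mulr0.
move: Z; apply: (dynkin_induction (P := fun Z => annihilates \1_(r @^-1` Z))).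
- exact: measurable_boxes.
- exact: setI_closed_boxes.
- by apply: annihilates_eq H1 => x; rewrite indicE mem_set.
- move=> _ [c ->].
  apply: annihilates_eq (annihilates_box mF Ffin mtheta mh c H1) => x.
  congr ((\1_ _) x); apply/seteqP; split => y /= yc i; have := yc i;
    by rewrite !mxE.
- move=> S mS HS.
  apply: annihilates_eq (annihilatesB mF Ffin mtheta mh H1 HS) => x /=.
  rewrite !indicE /cst; have [/set_mem xS|/negP xS] := boolP (x \in r @^-1` S).
    by rewrite memNset ?subrr// => /= /(_ xS).
  by rewrite mem_set ?subr0// => /= xS'; apply: xS; apply/mem_set.
- move=> S mS tS HS.
  pose w k x : R := \sum_(i < k) \1_(r @^-1` S i) x.
  have wE k x : w k x = \1_(\big[setU/set0]_(i < k) (r @^-1` S i)) x.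
    rewrite -(bigcup_mkord _ (fun i => r @^-1` S i)) indicE.
    have [/set_mem[i /= ik xi]|/negP nx] := boolP (x \in _).
      rewrite /w (bigD1 (Ordinal ik))//= indicE mem_set//.
      rewrite big1 ?addr0// => j ji; rewrite indicE memNset// => xj.
      move/trivIsetP: tS => /(_ (j : nat) i Logic.I Logic.I ji).
      by move=> /seteqP[/(_ (r x)) + _]; apply; split.
    rewrite /w big1// => i _; rewrite indicE memNset// => xi.
    by apply: nx; apply/mem_set; exists i => //=.
  have K := @annihilates_lim _ _ _ mu F mF Ffin theta mtheta n h mh w _ 1.
  apply: K.
  + elim=> [|k IHk].
      by apply: annihilates_eq H0 => x; rewrite /w big_ord0.
    apply: annihilates_eq (annihilatesD mF Ffin mtheta mh IHk (HS k)) => x.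
    by rewrite /w big_ord_recr.
  + by move=> k x; rewrite wE indicE; case: (_ \in _); rewrite ?normr1 ?normr0.
  + move=> x; have [[k _ xk]|nx] := pselect ((r @^-1` (\bigcup_k S k)) x).
    * apply: (@cvg_near_cst _ _ _ _ _ _ _) => //.
      exists k.+1 => // m /= km; rewrite wE !indicE !mem_set//; first by exists k.
      by rewrite -(bigcup_mkord _ (fun i => r @^-1` S i)); exists k.
    * apply: (@cvg_near_cst _ _ _ _ _ _ _) => //; apply: nearW => m.
      rewrite wE !indicE !memNset// -(bigcup_mkord _ (fun i => r @^-1` S i)) => -[k _ xk].
      by apply: nx; exists k.
Qed.

(** Restricting the weight to a positive cosine makes the integrand nonnegative with zero integral,
    so E, F and that set meet in a null set. The shifts 0, pi, pi / 2 and - pi / 2 cover everything,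
    as cos and sin have no common zero. *)
Lemma annihilates_null (E : set T) : measurable E ->
  (forall g, annihilates \1_(E `&` [set x | 0 < cos (2 * pi * theta x + g)])) ->
  mu (E `&` F) = 0%E.
Proof.
move=> mE HE.
pose f g x := cos (2 * pi * theta x + g).
have mf g : measurable_fun setT (f g).
  have := measurable_cos_phase mtheta mh (fun=> 0) g.
  rewrite (_ : _ \o _ = f g)//; apply/funext => x.
  by rewrite /= /phase /f big1 ?addr0// => i _; rewrite mul0r.
have mpos g : measurable [set x | 0 < f g x].
  rewrite -[X in measurable X]setTI.
  have := mf g measurableT `]0, +oo[%classic (measurable_itv _).
  by congr (measurable (_ `&` _)); apply/seteqP; split=> x /=; rewrite in_itv/= andbT.
have null g : mu.-negligible (F `&` (E `&` [set x | 0 < f g x])).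
  set A := E `&` _; have mA : measurable A by exact: measurableI.
  have [bA HA] := HE g.
  have intA := integrable_phase mF Ffin mtheta mh (fun=> 0) g bA.
  have cE x : cos (phase theta h (fun=> 0) g x) = f g x.
    by rewrite /phase big1 ?addr0// => i _; rewrite mul0r.
  have i0 : (\int[mu]_(x in F) `|(\1_A x * f g x)%:E| = 0)%E.
    have := HA (fun=> 0) g; rewrite /Rintegral.
    under eq_integral do rewrite cE.
    under [in X in _ -> X]eq_integral => x _.
      rewrite abse_EFin ger0_norm; last first.
        rewrite indicE; have [/set_mem[_ /= /ltW]|_] := boolP (x \in A).
          by rewrite mul1r.
        by rewrite mul0r.
      over.
    (* Only the [fine] part of the integral is known to vanish; integrability excludes an infinite
       value. *)
    move=> i0; rewrite -[LHS]fineK ?i0//.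
    have := integrable_fin_num mF intA.
    by congr (_ \is a fin_num); apply: eq_integral => x _ /=; rewrite cE.
  have mAf : measurable_fun F (fun x => (\1_A x * f g x)%:E).
    apply/measurable_EFinP/measurable_funTS; apply: measurable_funM => //.
  have /(ae_eq_integral_abs mu mF mAf) [N [mN N0 FN]] := i0.
  exists N; split => // x [Fx Ax]; apply: FN => /= /(_ Fx) /eqP.
  rewrite indicE mem_set// mul1r eqe => /eqP f0.
  by case: Ax => _ /=; rewrite f0 ltxx.
have -> : E `&` F = (F `&` (E `&` [set x | 0 < f 0 x])) `|`
    (F `&` (E `&` [set x | 0 < f pi x])) `|`
    ((F `&` (E `&` [set x | 0 < f (pi / 2) x])) `|`
     (F `&` (E `&` [set x | 0 < f (- (pi / 2)) x]))).
  apply/seteqP; split => x; last by case=> [[|]|[|]] [? []].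
  move=> [Ex Fx]; rewrite /f/= addr0 cosDpi cosDpihalf cosBpihalf !oppr_gt0.
  have := cos2Dsin2 (2 * pi * theta x).
  case: (ltgtP (cos (2 * pi * theta x)) 0) => [?|?|->]; [|by do 2 left|].
    by left; right.
  case: (ltgtP (sin (2 * pi * theta x)) 0) => [?|?|->];
    [by right; left|by right; right|].
  by rewrite expr0n/= addr0 => /eqP; rewrite eq_sym oner_eq0.
have mFE g : measurable (F `&` (E `&` [set x | 0 < f g x])).
  by apply: measurableI => //; exact: measurableI.
apply: null_set_setU; try by apply: measurableU.
  by apply: null_set_setU => //; apply/(negligibleP _ (mFE _))/null.
by apply: null_set_setU => //; apply/(negligibleP _ (mFE _))/null.
Qed.

End annihilates_borel.

(** * Measurable hulls for the outer measure *)

Section outer_regularity.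
Local Open Scope ereal_scope.
Context d (T : measurableType d) (R : realType) (mu : {measure set T -> \bar R}).

(** Intersect over k countable measurable covers whose total measure is below the outer measure plus
    1 / (k + 1). *)
Lemma mu_ext_measurable_hull (E : set T) : (mu^*)%mu E < +oo ->
  exists O, [/\ measurable O, E `<=` O & (mu^*)%mu E = mu O].
Proof.
move=> Eoo; have Efin : (mu^*)%mu E \is a fin_num.
  by rewrite ge0_fin_numE// outer_measure_ge0.
have /choice[A HA] k : exists A, measurable_cover E A /\
    \sum_(0 <= i <oo) mu (A i) < (mu^*)%mu E + k.+1%:R^-1%:E.
  have : (0 < k.+1%:R^-1 :> R)%R by rewrite invr_gt0.
  by move: Efin => /lb_ereal_inf_adherent/[apply] -[_ /= [A EA <-] lt]; exists A.
pose O_ k := \bigcup_i A k i.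
have mO_ k : measurable (O_ k).
  by apply: bigcupT_measurable => i; have [[/(_ i)]] := HA k.
have EO_ k : E `<=` O_ k by have [[]] := HA k.
have mO : measurable (\bigcap_k O_ k) by exact: bigcapT_measurable.
have EO : E `<=` \bigcap_k O_ k by exact: sub_bigcap.
exists (\bigcap_k O_ k); split=> //.
apply/eqP; rewrite eq_le; apply/andP; split.
  by rewrite -(measurable_mu_extE mu mO) le_outer_measure.
apply/lee_addgt0Pr => /= _/posnumP[e]; near \oo => n.
apply: (@le_trans _ _ (mu (O_ n))).
  by apply: le_measure; rewrite ?inE//; exact: bigcap_inf.
apply: (@le_trans _ _ (\sum_(0 <= i <oo) mu (A n i))).
  by apply: measure_sigma_subadditive => // i; have [[/(_ i)]] := HA n.
have [_ /ltW/le_trans] := HA n; apply.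
rewrite leeD// lee_fin ltW//; near: n; exact: near_infty_natSinv_lt.
Unshelve. all: by end_near. Qed.

End outer_regularity.

(** * Borel subsets of full measure in Lebesgue sets *)

Section lebesgue_inner.
Context (R : realType) (n : nat).

Lemma borel_lebesgue_measurable (E : set 'cV[R]_n) :
  measurable E -> lebesgue_measurable E.
Proof. exact: caratheodory_measurable_mu_ext. Qed.

Lemma measurable_id_lebesgue : measurable_fun setT (id : lebesgue_space R n -> 'cV[R]_n).
Proof. by move=> _ Y mY; rewrite setTI; exact: borel_lebesgue_measurable. Qed.

Lemma lebesgue_measurable_fun (f : 'cV[R]_n -> R) : measurable_fun setT f ->
  measurable_fun (setT : set (lebesgue_space R n)) f.
Proof. by move=> mf; exact: measurableT_comp mf measurable_id_lebesgue. Qed.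

(** With V a Borel hull of E and N a Borel hull of the null set V \ E, the set V \ N lies in E and
    misses only points of N. *)
Lemma lebesgue_measurable_inner (E : set 'cV[R]_n) :
  lebesgue_measurable E -> (lebesgue E < +oo)%E ->
  exists G : set 'cV[R]_n,
    [/\ measurable G, G `<=` E & lebesgue (E `\` G) = 0%E].
Proof.
move=> mE Efin.
have [V [mV EV muV]] := mu_ext_measurable_hull Efin.
have mVL := borel_lebesgue_measurable mV.
have lebE (X : set 'cV[R]_n) : measurable X -> lebesgue X = borel_lebesgue R n X.
  by move=> mX; exact: (measurable_mu_extE (borel_lebesgue R n) mX).
have VE0 : lebesgue (V `\` E) = 0%E.
  have VE : lebesgue V = lebesgue E by rewrite lebE// -muV.
  rewrite measureD//; last by rewrite -[X in (X < _)%E]/(lebesgue V) VE.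
  rewrite (_ : V `&` E = E); last exact: setIidr.
  rewrite -[X in (X - _)%E]/(lebesgue V) VE.
  by apply: subee; rewrite ge0_fin_numE.
have := mu_ext_measurable_hull (mu := borel_lebesgue R n) (E := V `\` E).
rewrite -[X in (X < _)%E]/(lebesgue (V `\` E)) VE0.
move=> /(_ (ltry _)) [N [mN ON muN]].
exists (V `\` N); split; first exact: measurableD.
  by move=> x [Vx Nx]; apply: contrapT => Ex; apply: Nx; exact: ON.
have mNL := borel_lebesgue_measurable mN.
have : (lebesgue (E `\` (V `\` N)) <= lebesgue N)%E.
  apply: le_measure; rewrite ?inE//.
    by apply: measurableD => //; exact: measurableD.
  move=> x [Ex VNx]; apply: contrapT => Nx; apply: VNx; split => //.
  exact: EV.
rewrite (lebE N mN) -muN -[X in (_ <= X)%E]/(lebesgue (V `\` E)) VE0 measure_le0.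
by move/eqP.
Qed.

End lebesgue_inner.

(** * Uniqueness of Fourier coefficients modulo a lattice *)

Section lattice_uniqueness.
Context d (T : measurableType d) (R : realType) (mu : {measure set T -> \bar R}).
Variables (n : nat) (iota : T -> 'cV[R]_n) (H : 'M[R]_n).
Hypothesis miota : measurable_fun setT iota.
Hypothesis unitH : H \in unitmx.
Variables (beta : 'cV[R]_n).
Let h (i : 'I_n) x : R := (H *m iota x) i ord0.
Let theta x : R := dotv beta (iota x).

(* When G is injective modulo H^-1 Z^n, every Borel part of G on which the floor of
   H v is constant is the trace on G of a preimage under the fractional part of H v. *)
Lemma annihilates_inj_null (G : set 'cV[R]_n) : measurable G ->
  (mu (iota @^-1` G) < +oo)%E ->
  (forall x y, G x -> G y ->
    (exists z : 'cV[int]_n, H *m (x - y) = map_mx intr z) -> x = y) ->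
  annihilates mu (iota @^-1` G) theta h (cst 1) -> mu (iota @^-1` G) = 0%E.
Proof.
move=> mG Gfin injG H1.
have mpre (S : set 'cV[R]_n) : measurable S -> measurable (iota @^-1` S).
  by move=> mS; rewrite -[X in measurable X]setTI; exact: miota.
have mtheta : measurable_fun setT theta.
  exact: measurableT_comp (measurable_dotv _) miota.
have mHv i : measurable_fun setT (fun v : 'cV[R]_n => (H *m v) i ord0).
  exact: measurableT_comp (measurable_vcoord i) (measurable_mulmx_cV H).
have mh i : measurable_fun setT (h i).
  exact: measurableT_comp (mHv i) miota.
pose r (v : 'cV[R]_n) : 'cV[R]_n := \col_i frac ((H *m v) i ord0).
pose fl (v : 'cV[R]_n) : 'cV[int]_n := \col_i Num.floor ((H *m v) i ord0).
have rE v : H *m v = r v + map_mx intr (fl v).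
  by apply/colP => i; rewrite !mxE /frac subrK.
pose E u := G `&` [set v | fl v = u].
have mE u : measurable (E u).
  apply: measurableI => //.
  rewrite (_ : mkset _ = \bigcap_(i : 'I_n)
    (fun v : 'cV[R]_n => (H *m v) i ord0 - frac ((H *m v) i ord0)) @^-1`
      [set (u i ord0)%:~R]).
    apply: fin_bigcap_measurable => // i _; rewrite -[X in measurable X]setTI.
    have mf : measurable_fun setT
        (fun v : 'cV[R]_n => (H *m v) i ord0 - frac ((H *m v) i ord0)).
      apply: measurable_funB => //.
      exact: measurableT_comp (@measurable_frac R) (mHv i).
    exact: mf measurableT _ (measurable_set1 _).
  apply/seteqP; split => [v /= <- i _|v vu]; first by rewrite /= [in RHS]mxE /frac subKr.
  apply/colP => i; have := vu i Logic.I; rewrite /= /frac subKr.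
  by move=> /eqP; rewrite eqr_int => /eqP; rewrite [fl v i _]mxE.
have key u (S : set 'cV[R]_n) : measurable S ->
    annihilates mu (iota @^-1` G) theta h \1_(iota @^-1` (E u `&` S)).
  move=> mS.
  (* A point of the torus is in Z when its lift with integer part u lies in [E u] and S. A point of
     G whose [r] is in Z is congruent to such a lift, which is itself in G, so the two agree by
     injectivity. *)
  pose Z := (fun v => invmx H *m (v + map_mx intr u)) @^-1` (E u `&` S).
  have mZ : measurable Z.
    rewrite -[Z]setTI.
    have : measurable_fun setT (fun v : 'cV[R]_n => invmx H *m (v + map_mx intr u)).
      exact: measurableT_comp (measurable_mulmx_cV _) (measurable_shift_cV _).
    by apply => //; exact: measurableI.
  have := annihilates_frac_preimage (mpre _ mG) Gfin mtheta mh mZ H1.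
  rewrite (_ : _ @^-1` Z = (r \o iota) @^-1` Z)//; apply: annihilates_eq_on.
    split; first by apply: measurable_indic; apply: mpre; exact: measurableI.
    by exists 1 => x; rewrite indicE; case: (_ \in _); rewrite ?normr1 ?normr0.
  move=> x Gx; congr (_%:R); congr nat_of_bool; apply/idP/idP; rewrite !inE/=.
  - rewrite /Z/= => EZ; suff -> : iota x = invmx H *m (r (iota x) + map_mx intr u).
      by [].
    apply: injG => //; first by case: EZ => [[]].
    exists (fl (iota x) - u); rewrite mulmxBr mulKVmx// rE map_mxB.
    by rewrite opprD addrACA subrr add0r.
  - move=> [[Gx' flx] Sx]; rewrite /Z /= -flx -rE mulKmx//.
have null u : mu (iota @^-1` (E u) `&` iota @^-1` G) = 0%E.
  apply: (@annihilates_null _ _ _ mu _ (mpre _ mG) Gfin theta mtheta n h mh).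
    exact: (mpre _ (mE u)).
  move=> g; rewrite (_ : _ `&` _ =
    iota @^-1` (E u `&` [set v | 0 < cos (2 * pi * dotv beta v + g)])) //.
  apply: key.
  have : measurable_fun setT (fun v => cos (2 * pi * dotv beta v + g)).
    apply: (@measurableT_comp _ _ _ _ _ _ cos).
      exact: continuous_measurable_fun (@continuous_cos R).
    apply: measurable_funD => //; apply: measurable_funM => //.
    exact: measurable_dotv.
  move=> /(_ measurableT `]0, +oo[%classic (measurable_itv _)).
  rewrite setTI; congr measurable; apply/seteqP.
  by split=> v /=; rewrite in_itv/= andbT.
apply/(negligibleP _ (mpre _ mG)).
(* The null pieces, one for each integer vector u, are numbered by [unpickle] and exhaust G. *)
pose EE k := if unpickle k is Some u
  then iota @^-1` (E u) `&` iota @^-1` G else set0.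
apply: (@negligibleS _ _ _ mu (\bigcup_k EE k)).
  move=> x Gx; exists (pickle (fl (iota x))) => //.
  by rewrite /EE pickleK; split => //; split.
apply: negligible_bigcup => k; rewrite /EE.
case: (unpickle k) => [u|]; last exact: negligible_set0.
have mEG : measurable (iota @^-1` (E u) `&` iota @^-1` G).
  by apply: measurableI; exact: mpre.
exact/(negligibleP _ mEG)/null.
Qed.

End lattice_uniqueness.

(** * Sets that pack by a lattice *)

Section packing.
Context (R : realType) (n : nat).
Local Notation intv z := (map_mx intr z : 'cV[R]_n).

Lemma dotvDl (a b x : 'cV[R]_n) : dotv (a + b) x = dotv a x + dotv b x.
Proof.
by rewrite /dotv -big_split/=; apply: eq_bigr => i _; rewrite mxE mulrDl.
Qed.

Lemma dotvNl (a x : 'cV[R]_n) : dotv (- a) x = - dotv a x.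
Proof. by rewrite /dotv -sumrN; apply: eq_bigr => i _; rewrite mxE mulNr. Qed.

Lemma dotv_trmx (H : 'M[R]_n) (z x : 'cV[R]_n) :
  dotv (H^T *m z) x = dotv z (H *m x).
Proof.
rewrite /dotv; under eq_bigr do rewrite mxE mulr_suml.
rewrite exchange_big/=; apply: eq_bigr => i _; rewrite mxE mulr_sumr.
by apply: eq_bigr => j _; rewrite mxE; ring.
Qed.

Lemma measurable_trig (f : R -> R) (b : 'cV[R]_n) : continuous f ->
  measurable_fun (setT : set (lebesgue_space R n)) (fun x => f (2 * pi * dotv b x)).
Proof.
move=> cf; apply: lebesgue_measurable_fun.
apply: measurableT_comp (continuous_measurable_fun cf) _.
by apply: measurable_funM => //; exact: measurable_dotv.
Qed.

Lemma integrable_trig (F : set (lebesgue_space R n)) (f : R -> R) (b : 'cV[R]_n) :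
  measurable F -> (lebesgue F < +oo)%E ->
  continuous f -> (forall t, `|f t| <= 1) ->
  (@lebesgue R n).-integrable F (EFin \o (fun x => f (2 * pi * dotv b x))).
Proof.
move=> mF Ffin cf f1.
apply: (measurable_bounded_integrable mF Ffin).
  exact: measurable_funTS (measurable_trig b cf).
exists 1; split; first by rewrite num_real.
by move=> y y1 x _ /=; rewrite (le_trans (f1 _))// ltW.
Qed.

(** Discarding a null set from F leaves a Borel set with truly disjoint translates, to which
    [annihilates_inj_null] applies; the integrals do not change. *)
Lemma packing_null (F : set 'cV[R]_n) (H : 'M[R]_n) (beta : 'cV[R]_n) :
  H \in unitmx -> lebesgue_measurable F -> (lebesgue F < +oo)%E ->
  (forall z : 'cV[int]_n, z != 0 ->
    (@lebesgue R n).-negligible [set x | F x /\ F (x - invmx H *m intv z)]) ->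
  (forall (z : 'cV[int]_n) (g : R), (\int[@lebesgue R n]_(x in F)
     cos (2 * pi * dotv (beta + H^T *m intv z) x + g))%R = 0) ->
  lebesgue F = 0%E.
Proof.
move=> unitH mF Ffin packF HF.
have [G0 [mG0 G0F FG0]] := lebesgue_measurable_inner mF Ffin.
pose W z := [set x | G0 (x - invmx H *m intv z)].
have mW z : measurable (W z).
  rewrite -[X in measurable X]setTI.
  exact: (measurable_shift_cV (- (invmx H *m intv z)) measurableT mG0).
(* U is the union of the translates of G0 by nonzero lattice vectors; of two distinct congruent
   points of G0, each lies in U. *)
pose U := \bigcup_k (if unpickle k is Some z then
  if z == 0 then set0 else W z else set0 : set 'cV[R]_n).
have mU : measurable U.
  apply: bigcupT_measurable => k; case: (unpickle k) => // z.
  by case: ifP.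
pose G := G0 `\` U.
have mG : measurable G by exact: measurableD.
have GF : G `<=` F by move=> x [/G0F].
have mGL := borel_lebesgue_measurable mG.
have FGnull : lebesgue (F `\` G) = 0%E.
  apply: (measure_negligible (mu := @lebesgue R n)).
    exact: (measurableD mF mGL).
  pose V k : set 'cV[R]_n := if unpickle k is Some z then
    if z == 0 then set0 else [set x | F x /\ F (x - invmx H *m intv z)]
    else set0.
  apply: (@negligibleS _ _ _ (@lebesgue R n) ((F `\` G0) `|` \bigcup_k V k)).
    move=> x [Fx Gx]; have [G0x|] := pselect (G0 x); last by left.
    right; have [[k _ Wx]|Ux] := pselect (U x); last by case: Gx.
    exists k => //; rewrite /V; case: (unpickle k) Wx => // z.
    by case: ifP => // _ /G0F.
  apply: negligibleU.
    apply/negligibleP => //; apply: measurableD => //.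
    exact: borel_lebesgue_measurable.
  apply: negligible_bigcup => k; rewrite /V.
  case: (unpickle k) => [z|]; last first.
    exact: negligible_set0.
  case: ifPn => z0; first exact: negligible_set0.
  exact: packF.
have Gfin : (lebesgue G < +oo)%E.
  by apply: le_lt_trans Ffin; apply: le_measure; rewrite ?inE.
suff G0' : lebesgue G = 0%E.
  have -> : F = G `|` (F `\` G) by rewrite setDUK.
  apply: (@null_set_setU _ _ _ (@lebesgue R n)) => //.
  exact: (measurableD mF mGL).
have key := @annihilates_inj_null _ _ _ (@lebesgue R n) n id H
  (@measurable_id_lebesgue R n) unitH beta G mG Gfin.
apply: key.
  move=> x y [Gx Ux] [Gy _] [z xyz]; apply/eqP; rewrite -subr_eq0; apply/eqP.
  have xyE : x - y = invmx H *m intv z by rewrite -xyz mulKmx.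
  have [z0|z0] := eqVneq z 0.
    by rewrite xyE z0 map_mx0 mulmx0.
  exfalso; apply: Ux; exists (pickle z) => //.
  by rewrite pickleK (negbTE z0) /W/= -xyE subKr.
split; first exact: bounded_measurable_cst.
move=> z g; rewrite -[RHS](HF (\col_i z i) g).
have E x : cst 1 x * cos (phase (fun x => dotv beta x)
    (fun i x => (H *m x) i ord0) z g x) =
    cos (2 * pi * dotv (beta + H^T *m intv (\col_i z i)) x + g).
  rewrite mul1r /phase dotvDl dotv_trmx; congr (cos (_ * (_ + _) + _)).
  by apply: eq_bigr => i _; rewrite !mxE.
under eq_Rintegral do rewrite E.
rewrite /Rintegral; congr fine.
rewrite [RHS](negligible_integral (measurableD mF mGL))//.
  by rewrite setDD setIidr.
apply: (@integrable_trig F (fun t => cos (t + g))) => //; last first.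
  by move=> t; exact: cos_max.
move=> t; apply: continuous_comp; last exact: continuous_cos.
by apply: cvgD; [exact: cvg_id|exact: cvg_cst].
Qed.

End packing.

(** * Complex-valued measurable functions and their square norms *)

Section complex_measurable.
Local Open Scope complex_scope.
Context (R : realType) (n : nat).
Local Notation mu := (@lebesgue R n).
Implicit Types (f g : 'cV[R]_n -> R[i]) (D : set (lebesgue_space R n)).

Lemma cmeasurable_cst D (a : R[i]) : cmeasurable D (cst a).
Proof. by split; exact: measurable_cst. Qed.

Lemma cmeasurableD D f g : cmeasurable D f -> cmeasurable D g ->
  cmeasurable D (fun x => f x + g x).
Proof.
move=> [mRf mIf] [mRg mIg]; split.
- rewrite (_ : (fun _ => _) = fun x => complex.Re (f x) + complex.Re (g x)).
    exact: measurable_funD.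
  by apply/funext => x; case: (f x) => ? ?; case: (g x).
- rewrite (_ : (fun _ => _) = fun x => complex.Im (f x) + complex.Im (g x)).
    exact: measurable_funD.
  by apply/funext => x; case: (f x) => ? ?; case: (g x).
Qed.

Lemma cmeasurableZ D (a : R[i]) f : cmeasurable D f ->
  cmeasurable D (fun x => a * f x).
Proof.
move=> [mRf mIf]; case: a => p q; split.
- rewrite (_ : (fun _ => _) = fun x => p * complex.Re (f x) - q * complex.Im (f x)).
    by apply: measurable_funB; exact: measurable_funM.
  by apply/funext => x; case: (f x).
- rewrite (_ : (fun _ => _) = fun x => p * complex.Im (f x) + q * complex.Re (f x)).
    by apply: measurable_funD; exact: measurable_funM.
  by apply/funext => x; case: (f x) => ? ? /=.
Qed.

Lemma cmeasurable_sum (T : eqType) D (s : seq T) (e : T -> 'cV[R]_n -> R[i]) :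
  (forall i, i \in s -> cmeasurable D (e i)) ->
  cmeasurable D (fun x => \sum_(i <- s) e i x).
Proof.
elim: s => [|i s IHs] ms.
  rewrite (_ : (fun _ => _) = cst 0); first exact: cmeasurable_cst.
  by apply/funext => x; rewrite big_nil.
rewrite (_ : (fun _ => _) = fun x => e i x + \sum_(j <- s) e j x); last first.
  by apply/funext => x; rewrite big_cons.
apply: cmeasurableD; first by apply: ms; rewrite inE eqxx.
by apply: IHs => j js; apply: ms; rewrite inE js orbT.
Qed.

Lemma normc_sqr (z : R[i]) :
  Normc.normc z ^+ 2 = complex.Re z ^+ 2 + complex.Im z ^+ 2.
Proof. by case: z => a b; rewrite /Normc.normc sqr_sqrtr ?addr_ge0 ?sqr_ge0. Qed.

Lemma measurable_normc_sqr D f : cmeasurable D f ->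
  measurable_fun D (fun x => (Normc.normc (f x) ^+ 2)%:E).
Proof.
move=> [mRf mIf]; apply/measurable_EFinP.
under eq_fun do rewrite normc_sqr.
by apply: measurable_funD; exact: measurable_funX.
Qed.

Lemma le_sqnorm D E f : measurable D -> measurable E -> D `<=` E ->
  cmeasurable E f -> (sqnorm D f <= sqnorm E f)%E.
Proof.
move=> mD mE DE mf.
apply: (ge0_subset_integral _ mD mE (measurable_normc_sqr mf) _ DE).
by move=> x _; rewrite lee_fin sqr_ge0.
Qed.

Lemma eq_sqnorm D f g : (forall x, D x -> f x = g x) -> sqnorm D f = sqnorm D g.
Proof. by move=> fg; apply: eq_integral => x /set_mem Dx; rewrite fg. Qed.

Lemma sqnorm_negligible D N f : measurable D -> measurable N -> mu N = 0%E ->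
  cmeasurable D f -> sqnorm D f = sqnorm (D `\` N) f.
Proof.
move=> mD mN N0 mf.
apply: (ge0_negligible_integral mN mD (measurable_normc_sqr mf) _ N0).
by move=> x _; rewrite lee_fin sqr_ge0.
Qed.

Lemma sqnorm1 D : measurable D -> sqnorm D (cst 1) = mu D.
Proof.
move=> mD; rewrite /sqnorm.
rewrite -[RHS]mul1e -[RHS]integral_cst//; apply: eq_integral => x _.
by rewrite normc_sqr /= expr0n addr0 expr1n.
Qed.

Lemma cmeasurable_patch0 D f : measurable D -> cmeasurable D f ->
  cmeasurable setT (fun x => if x \in D then f x else 0).
Proof.
move=> mD [mRf mIf]; split.
- rewrite (_ : (fun _ => _) = (fun x => complex.Re (f x)) \_ D).
    exact/(measurable_restrictT _ mD).
  by apply/funext => x; rewrite patchE; case: ifP.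
- rewrite (_ : (fun _ => _) = (fun x => complex.Im (f x)) \_ D).
    exact/(measurable_restrictT _ mD).
  by apply/funext => x; rewrite patchE; case: ifP.
Qed.

Lemma sqnorm_patch0 D f : measurable D ->
  sqnorm setT (fun x => if x \in D then f x else 0) = sqnorm D f.
Proof.
move=> mD; rewrite /sqnorm [RHS]integral_mkcond; apply: eq_integral => x _.
rewrite patchE; case: ifP => // _.
by rewrite normc_sqr /= expr0n addr0.
Qed.

End complex_measurable.

(** * The Gabor basis: packing, tiling and spectrum *)

Section gabor_packing.
Local Open Scope complex_scope.
Context (R : realType) (n : nat).
Local Notation mu := (@lebesgue R n).
Local Notation intv z := (map_mx intr z : 'cV[R]_n).
Variables (K : set 'cV[R]_n) (H : 'M[R]_n) (Lam : set 'cV[R]_(n + n)).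
Hypotheses (mK : lebesgue_measurable K) (Kpos : (0 < mu K)%E).
Hypothesis bK : bounded_set K.
Hypothesis unitH : H \in unitmx.
Hypothesis Lam0 : Lam 0.
Hypothesis Lam_shift : forall w (z : 'cV[int]_n), Lam w ->
  Lam (w + col_mx 0 (H^T *m intv z)).
Hypothesis Lam_usub : forall w, Lam w ->
  exists z : 'cV[int]_n, usubmx w = invmx H *m intv z.
Hypothesis Lam_fiber : forall z : 'cV[int]_n,
  exists b, Lam (col_mx (invmx H *m intv z) b).
Hypothesis gaborK : gabor_orthonormal_basis (normalized_indicator K) Lam.

Let c : R := (Num.sqrt (fine (mu K)))^-1.
Let e w := tf_shift w (normalized_indicator K).

Lemma tf_shiftE (w : 'cV[R]_(n + n)) x : e w x =
  (c * \1_K (x - usubmx w) * cos (2 * pi * dotv (dsubmx w) x)) +i*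
  (c * \1_K (x - usubmx w) * sin (2 * pi * dotv (dsubmx w) x)).
Proof.
rewrite /e /tf_shift /character /normalized_indicator -/c.
by apply/eqP; rewrite eq_complex /=; apply/andP; split; apply/eqP; ring.
Qed.

Lemma gabor_set_finite : (mu K < +oo)%E.
Proof.
rewrite ltey; apply/eqP => Koo; have [[L2e _ _] _] := gaborK.
have [_ /eqP] := L2e _ Lam0; apply.
(* By the default values [fine] of +oo is 0 and 0^-1 is 0, so the window would vanish, against the
   nonzero norm of the element at w = 0. *)
have c0 : c = 0 by rewrite /c Koo /= sqrtr0 invr0.
have e0 x : tf_shift 0 (normalized_indicator K) x = 0.
  by rewrite -/(e 0 x) tf_shiftE c0 !mul0r.
rewrite /inner /cintegral.
under eq_Rintegral do rewrite e0 mul0r/=.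
under [X in _ +i* X]eq_Rintegral do rewrite e0 mul0r/=.
by rewrite !Rintegral_cst// !mul0r.
Qed.

Lemma normalization_gt0 : 0 < c.
Proof. by rewrite invr_gt0 sqrtr_gt0 fine_gt0// Kpos gabor_set_finite. Qed.

Definition translate (p : 'cV[int]_n) : set 'cV[R]_n :=
  [set x | K (x - invmx H *m intv p)].

Lemma indic_translate (w : 'cV[R]_(n + n)) p x : usubmx w = invmx H *m intv p ->
  \1_K (x - usubmx w) = \1_(translate p) x :> R.
Proof.
by move=> ->; rewrite !indicE; congr (_%:R); congr nat_of_bool;
  apply/idP/idP; rewrite !inE.
Qed.

Lemma normc_tf_shift (w : 'cV[R]_(n + n)) p x : usubmx w = invmx H *m intv p ->
  Normc.normc (e w x) ^+ 2 = c ^+ 2 * \1_(translate p) x.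
Proof.
move=> wp; rewrite tf_shiftE /Normc.normc (indic_translate _ wp).
rewrite sqr_sqrtr ?addr_ge0 ?sqr_ge0// !exprMn -mulrDr cos2Dsin2 mulr1.
by congr (_ * _); rewrite indicE; case: (_ \in _); rewrite ?expr1n// expr0n.
Qed.

(** Read off from a Gabor element above p, measurable as a member of L^2: its squared modulus is c^2
    times the indicator of the translate. *)
Lemma translate_measurable p : lebesgue_measurable (translate p).
Proof.
have [b Lb] := Lam_fiber p.
have [[L2e _ _] _] := gaborK.
have [[[mRe mIm] _] _] := L2e _ Lb.
have wp : usubmx (col_mx (invmx H *m intv p) b) = invmx H *m intv p.
  exact: col_mxKu.
have mf : measurable_fun (setT : set (lebesgue_space R n))
    (fun x => c ^+ 2 * \1_(translate p) x).
  rewrite (_ : (fun _ => _) = fun x => complex.Re (e (col_mx (invmx H *m intv p) b) x) ^+ 2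
     + complex.Im (e (col_mx (invmx H *m intv p) b) x) ^+ 2).
    by apply: measurable_funD; exact: measurable_funX.
  apply/funext => x; rewrite -(normc_tf_shift x wp) /Normc.normc.
  case: (e _ x) => u v /=.
  by rewrite sqr_sqrtr ?addr_ge0 ?sqr_ge0.
rewrite /lebesgue_measurable -[X in measurable X]setTI.
have := mf measurableT `]0, +oo[%classic (measurable_itv _).
congr (measurable (_ `&` _)); apply/seteqP; split => x /=; rewrite in_itv/= andbT indicE.
  by have [/set_mem//|_] := boolP (x \in _); rewrite mulr0 ltxx.
by move=> px; rewrite mem_set// mulr1 exprn_gt0// normalization_gt0.
Qed.

Lemma translate_finite p : (mu (translate p) < +oo)%E.
Proof.
have [b Lb] := Lam_fiber p.
have [[L2e _ _] _] := gaborK.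
have [[_ +] _] := L2e _ Lb; rewrite /sqnorm.
have wp : usubmx (col_mx (invmx H *m intv p) b) = invmx H *m intv p.
  exact: col_mxKu.
under eq_integral do rewrite (normc_tf_shift _ wp) EFinM.
have mp := translate_measurable p.
have mi : measurable_fun (setT : set (lebesgue_space R n))
    (fun x => (\1_(translate p) x : R)%:E).
  by apply/measurable_EFinP; exact: measurable_indic.
rewrite (ge0_integralZl _ measurableT mi); last 2 first.
- by move=> x _; rewrite lee_fin.
- by rewrite lee_fin exprn_ge0// ltW// normalization_gt0.
rewrite (integral_indic _ _ mp) ?setIT//.
rewrite -[X in (_ * X < _)%E]/(mu (translate p)).
apply: contraTT; rewrite -!leNgt !leye_eq => /eqP ->.
by rewrite mulry gtr0_sg ?exprn_gt0 ?normalization_gt0// mul1e.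
Qed.

(** The inner product is c^2 times the integral of a character over the overlap; its real and
    imaginary parts give g = 0 and the sine, and the addition formula gives every g. *)
Lemma tf_shift_orthogonal (w w' : 'cV[R]_(n + n)) p q (g : R) :
  Lam w -> Lam w' -> w != w' ->
  usubmx w = invmx H *m intv p -> usubmx w' = invmx H *m intv q ->
  (\int[mu]_(x in translate p `&` translate q)
      cos (2 * pi * dotv (dsubmx w - dsubmx w') x + g))%R = 0.
Proof.
move=> Lw Lw' ww' wp wq; have [[L2e orth _] _] := gaborK.
have inner0 := orth _ _ Lw Lw' ww'.
have Re0 : (\int[mu]_(x in setT) complex.Re (e w x * (e w' x)^*))%R = 0.
  exact: (congr1 (@complex.Re R) inner0).
have Im0 : (\int[mu]_(x in setT) complex.Im (e w x * (e w' x)^*))%R = 0.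
  exact: (congr1 (@complex.Im R) inner0).
set F := translate p `&` translate q.
pose th x := 2 * pi * dotv (dsubmx w - dsubmx w') x.
have mF : lebesgue_measurable F.
  by apply: measurableI; exact: translate_measurable.
have Ffin : (mu F < +oo)%E.
  apply: le_lt_trans (translate_finite p); apply: le_measure; rewrite ?inE//.
    exact: translate_measurable.
  exact: subIsetl.
have icos := integrable_trig (dsubmx w - dsubmx w') mF Ffin (@continuous_cos R)
  (@cos_max R).
have isin := integrable_trig (dsubmx w - dsubmx w') mF Ffin (@continuous_sin R)
  (@sin_max R).
have indF x : \1_(translate p) x * \1_(translate q) x = \1_F x :> R.
  by rewrite /F indicI.
have thE x : th x = 2 * pi * dotv (dsubmx w) x - 2 * pi * dotv (dsubmx w') x.
  by rewrite /th !dotvDl dotvNl; ring.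
have ReE x : complex.Re (e w x * (e w' x)^*) = ((fun x => c ^+ 2 * cos (th x)) \_ F) x.
  rewrite patchE; transitivity (c ^+ 2 * (x \in F)%:R * cos (th x)).
    rewrite -indicE -indF thE cosB !tf_shiftE /=.
    by rewrite (indic_translate _ wp) (indic_translate _ wq); ring.
  by case: (x \in F); rewrite ?mulr1// mulr0 mul0r.
have ImE x : complex.Im (e w x * (e w' x)^*) = ((fun x => c ^+ 2 * sin (th x)) \_ F) x.
  rewrite patchE; transitivity (c ^+ 2 * (x \in F)%:R * sin (th x)).
    rewrite -indicE -indF thE sinB !tf_shiftE /=.
    by rewrite (indic_translate _ wp) (indic_translate _ wq); ring.
  by case: (x \in F); rewrite ?mulr1// mulr0 mul0r.
have c2 : c ^+ 2 != 0 by rewrite gt_eqF// exprn_gt0// normalization_gt0.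
have cos0 : (\int[mu]_(x in F) cos (th x))%R = 0.
  apply: (mulfI c2); rewrite mulr0 -RintegralZl// -Re0 Rintegral_mkcond.
  by apply: eq_Rintegral => x _; rewrite ReE.
have sin0 : (\int[mu]_(x in F) sin (th x))%R = 0.
  apply: (mulfI c2); rewrite mulr0 -RintegralZl// -Im0 Rintegral_mkcond.
  by apply: eq_Rintegral => x _; rewrite ImE.
rewrite -/th; under eq_Rintegral do rewrite cosD.
rewrite RintegralB//.
- by rewrite !RintegralZr// cos0 sin0 !mul0r subr0.
- exact: (integrableZr mF _ icos).
- exact: (integrableZr mF _ isin).
Qed.

(** Adding (0, H^T z) to a point above p keeps it in [Lam] and above p, so one overlap is tested
    against a whole coset of frequencies. *)
Lemma translate_orthogonal p q : p != q ->
  exists beta : 'cV[R]_n, forall (z : 'cV[int]_n) (g : R),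
    (\int[mu]_(x in translate p `&` translate q)
      cos (2 * pi * dotv (beta + H^T *m intv z) x + g))%R = 0.
Proof.
move=> pq; have [bp Lp] := Lam_fiber p; have [bq Lq] := Lam_fiber q.
exists (bp - bq) => z g.
have := Lam_shift z Lp; rewrite add_col_mx addr0.
set w := col_mx _ _ => Lw.
set w' := col_mx _ bq in Lq.
have wp : usubmx w = invmx H *m intv p by exact: col_mxKu.
have wq : usubmx w' = invmx H *m intv q by exact: col_mxKu.
have ww' : w != w'.
  apply: contraNN pq => /eqP ww; apply/eqP.
  have : H *m usubmx w = H *m usubmx w' by rewrite ww.
  rewrite wp wq !mulKVmx// => /matrixP E; apply/matrixP => i j.
  by have := E i j; rewrite !mxE => /eqP; rewrite eqr_int => /eqP.
rewrite -(tf_shift_orthogonal g Lw Lq ww' wp wq) !col_mxKd.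
by rewrite addrAC.
Qed.

(** Squared Euclidean length, kept in the integers so that induction on it is possible. *)
Definition sqn (v : 'cV[int]_n) : int := \sum_i v i ord0 ^+ 2.

Lemma sqn_ge1 v : v != 0 -> 1 <= sqn v.
Proof.
move=> v0; rewrite -gtz0_ge1 lt0r sumr_ge0 ?andbT => [|i _]; last exact: sqr_ge0.
apply: contra v0; rewrite psumr_eq0 => [/allP v0|i _]; last exact: sqr_ge0.
apply/eqP/colP => i; rewrite mxE; apply/eqP.
by have := v0 i (mem_index_enum i); rewrite sqrf_eq0.
Qed.

Lemma sqn_parallelogram u v : sqn (u - v) + sqn (u + v) = 2 * sqn u + 2 * sqn v.
Proof.
rewrite /sqn -!big_split/= !mulr_sumr -big_split/=; apply: eq_bigr => i _.
by rewrite !mxE; ring.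
Qed.

(** A common point makes H^-1 (p - q) a difference of two points of the bounded set K, which bounds
    p - q. *)
Lemma translate_disjoint : exists M : int, forall p q,
  M < sqn (p - q) -> translate p `&` translate q = set0.
Proof.
have [C [_ /(_ (C + 1))]] := bK; rewrite ltrDl ltr01 => /(_ isT) KC.
(* [B i] bounds the i-th coordinate of H y when y has norm at most 2 (C + 1); C + 1 appears because
   only numbers above C are known to bound K. *)
pose B i := (\sum_j `|H i j|) * (2 * (C + 1)).
exists (Num.floor (\sum_i B i ^+ 2)) => p q.
apply: contraPP => /eqP/set0P[x [px qx]]; apply/negP; rewrite -leNgt.
rewrite floor_ge_int /sqn rmorph_sum/= ler_sum// => i _.
set y := invmx H *m intv (p - q).
have yC : `|y| <= 2 * (C + 1).
  have -> : y = (x - invmx H *m intv q) - (x - invmx H *m intv p).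
    by rewrite /y map_mxB mulmxBr opprB [RHS]addrC addrA subrK.
  rewrite (le_trans (ler_normB _ _))// mulr_natl mulr2n.
  by rewrite lerD//; exact: KC.
have E : ((p - q) i ord0)%:~R = (H *m y) i ord0.
  by rewrite mulKVmx// [RHS]mxE.
rewrite rmorphXn/= E -real_normK ?num_real// ler_sqr ?nnegrE//; last first.
  by rewrite mulr_ge0 ?sumr_ge0// (le_trans _ yC).
rewrite mxE (le_trans (ler_norm_sum _ _ _))// /B mulr_suml ler_sum// => j _.
rewrite normrM ler_wpM2l// (le_trans _ yC)//.
by rewrite [leRHS]/Num.Def.normr/= mx_normrE; exact: (le_bigmax _ _ (j, ord0)).
Qed.

(* Among the pairs of overlapping translates, one with p - q longest overlaps in a
   set F that packs: by the parallelogram law F and F + s overlap inside a pair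
   whose difference p - q + s or p - q - s is longer. *)
Lemma translate_null p q : p != q -> mu (translate p `&` translate q) = 0%E.
Proof.
have sqn1 a b : a != b -> 1 <= sqn (a - b).
  by move=> ab; rewrite sqn_ge1// subr_eq0.
have [M HM] := translate_disjoint.
have [m Mm] : exists m : nat, M < m%:Z.
  by exists `|M|.+1; lia.
(* Downward induction on squared length: k bounds how far [sqn (p - q)] falls short of m, beyond
   which overlaps are empty. *)
suff key (k : nat) : forall p q, p != q -> m%:Z < sqn (p - q) + k%:Z ->
    mu (translate p `&` translate q) = 0%E.
  by move=> pq; apply: (key m.+1 _ _ pq); have := sqn1 _ _ pq; lia.
elim: k => [|k IHk] {}p {}q pq.
  by rewrite addr0 => mpq; rewrite HM ?measure0// (lt_trans Mm).
move=> mpq.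
have [mp mq] := (translate_measurable p, translate_measurable q).
have [beta Hb] := translate_orthogonal pq.
have mF : lebesgue_measurable (translate p `&` translate q).
  exact: (measurableI _ _ mp mq).
apply: (packing_null unitH mF _ _ Hb).
  apply: le_lt_trans (translate_finite p).
  by apply: le_measure; rewrite ?inE; [exact: mF|exact: mp|exact: subIsetl].
move=> s s0.
have sub r : [set x | translate r (x - invmx H *m intv s)] `<=` translate (r + s).
  by move=> x; rewrite /translate/= map_mxD mulmxDr opprD addrCA addrC.
have h0 := sqn1 _ _ pq.
have h1 := sqn_ge1 s0; have h2 := sqn_parallelogram (p - q) s.
have neq a b : sqn (p - q) < sqn (a - b) -> a != b.
  move=> lt; apply/eqP => ab; move: lt; rewrite ab subrr [X in _ < X]big1 => [|i _].
    by lia.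
  by rewrite mxE expr0n.
have mI a b : lebesgue_measurable (translate a `&` translate b).
  by apply: measurableI; exact: translate_measurable.
have [h3|h3] := ltP (sqn (p - q)) (sqn (p - q - s)).
  have {}h3 : sqn (p - q) < sqn (p - (q + s)) by rewrite opprD addrA.
  apply: (@negligibleS _ _ _ mu (translate p `&` translate (q + s))).
    by move=> x [[px qx] [px' qx']]; split => //; exact: sub.
  by apply/(negligibleP _ (mI _ _)); apply: IHk; [exact: neq|lia].
have {}h3 : sqn (p - q) < sqn (p + s - q).
  rewrite (addrAC p s); move: h0 h1 h2 h3.
  move: (sqn (p - q - s)) (sqn (p - q + s)) (sqn (p - q)) (sqn s) => a b c' d'.
  by lia.
apply: (@negligibleS _ _ _ mu (translate (p + s) `&` translate q)).
  by move=> x [[px qx] [px' qx']]; split => //; exact: sub.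
by apply/(negligibleP _ (mI _ _)); apply: IHk; [exact: neq|lia].
Qed.

Lemma gabor_approx (f : 'cV[R]_n -> R[i]) (eps : R) : L2 setT f -> 0 < eps ->
  exists (s : seq 'cV[R]_(n + n)) (a : 'cV[R]_(n + n) -> R[i]),
    [/\ [set` s] `<=` Lam, cmeasurable setT (fun x => f x - \sum_(w <- s) a w * e w x)
      & (sqnorm setT (fun x => f x - \sum_(w <- s) a w * e w x)%R < eps%:E)%E].
Proof.
move=> L2f eps0; have [[L2e _ dense] _] := gaborK.
have [s [a [sL lt]]] := dense _ L2f _ eps0.
exists s, a; split; [exact: sL| |exact: lt].
have ms : cmeasurable setT (fun x => \sum_(w <- s) a w * e w x).
  apply: (cmeasurable_sum (e := fun w x => a w * e w x)) => w ws.
  by apply: cmeasurableZ; have [[]] := L2e _ (sL _ ws).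
rewrite (_ : (fun _ => _) = fun x => f x + (-1) * \sum_(w <- s) a w * e w x).
  by apply: cmeasurableD; [exact: L2f.1|exact: cmeasurableZ].
by apply/funext => x; rewrite mulN1r.
Qed.

Let enumerate (S : 'cV[int]_n -> set 'cV[R]_n) k : set 'cV[R]_n :=
  if unpickle k is Some p then S p else set0.

Let bigcup_enumerate S x : (\bigcup_k enumerate S k) x <-> exists p, S p x.
Proof.
split => [[k _]|[p px]]; last by exists (pickle p) => //; rewrite /enumerate pickleK.
by rewrite /enumerate; case: (unpickle k) => // p; exists p.
Qed.

(** All Gabor elements vanish off the translates. On a piece A of finite measure of the uncovered
    set, no combination improves the approximation of the indicator of A, so the measure of A is
    below every eps. *)
Lemma uncovered_null : mu.-negligible (~` \bigcup_k enumerate translate k).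
Proof.
have mU : lebesgue_measurable (~` \bigcup_k enumerate translate k).
  apply: measurableC; apply: bigcupT_measurable => k; rewrite /enumerate.
  by case: (unpickle k) => // p; exact: translate_measurable.
have [F TF mF] := completed_measure_extension_sigma_finite
  (sigma_finiteT (borel_lebesgue R n)).
set Z := ~` _.
apply: (@negligibleS _ _ _ mu (\bigcup_k (Z `&` F k))).
  move=> x Zx; have : (\bigcup_k F k) x by rewrite -TF.
  by move=> [k _ Fx]; exists k.
apply: negligible_bigcup => k.
have [mFk Fkfin] := mF k.
have mA : lebesgue_measurable (Z `&` F k) by exact: (measurableI _ _ mU mFk).
apply/(negligibleP _ mA).
set A := Z `&` F k.
have Afin : (mu A < +oo)%E.
  by apply: le_lt_trans Fkfin; apply: le_measure; rewrite ?inE//; exact: subIsetr.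
pose f (x : 'cV[R]_n) : R[i] := if x \in A then cst 1 x else 0.
have L2f : L2 setT f.
  split; first exact: (cmeasurable_patch0 mA (cmeasurable_cst _ _)).
  by rewrite (sqnorm_patch0 _ mA) (sqnorm1 mA).
apply/eqP; rewrite -measure_le0; apply/lee_addgt0Pr => eps eps0.
have [s [a [sL mh]]] := gabor_approx L2f eps0.
rewrite add0e => /ltW; apply: le_trans.
rewrite -[X in (X <= _)%E]/(mu A) -(sqnorm1 mA).
apply: le_trans (le_sqnorm mA measurableT (@subsetT _ _) mh).
rewrite le_eqVlt; apply/orP; left; apply/eqP; apply: eq_sqnorm => x Ax.
rewrite /f mem_set// big1_seq ?subr0// => w /andP[_ ws].
have [p wp] := Lam_usub (sL _ ws).
rewrite tf_shiftE (indic_translate _ wp) indicE memNset ?mulr0 ?mul0r.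
  by rewrite (_ : 0 +i* 0 = 0) ?mulr0.
by move=> px; case: Ax => + _; apply; apply/(bigcup_enumerate translate x); exists p.
Qed.

Lemma gabor_tiles : tiles K.
Proof.
exists (range (fun z : 'cV[int]_n => invmx H *m intv z)); split.
  exact: sub_countable (card_image_le _ _) (countableP _).
(* Off the uncovered set and the overlaps of distinct translates, x lies in exactly one
   translate. *)
pose W p q := if p == q then set0 else translate p `&` translate q.
apply: (@negligibleS _ _ _ mu ((~` \bigcup_k enumerate translate k) `|`
    \bigcup_k enumerate (fun p => \bigcup_l enumerate (W p) l) k)); last first.
  apply: negligibleU; first exact: uncovered_null.
  apply: negligible_bigcup => k; rewrite {1}/enumerate.
  case: (unpickle k) => [p|]; last exact: negligible_set0.
  apply: negligible_bigcup => l; rewrite /enumerate.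
  case: (unpickle l) => [q|]; last exact: negligible_set0.
  rewrite /W; case: ifPn => [_|pq]; first exact: negligible_set0.
  have mpq : lebesgue_measurable (translate p `&` translate q).
    exact: (measurableI _ _ (translate_measurable p) (translate_measurable q)).
  by apply/(negligibleP _ mpq); exact: translate_null.
move=> x; apply: contra_notP => /not_orP[/contrapT/(bigcup_enumerate translate x)[p px]] nW.
have uniq q : translate q x -> q = p.
  move=> qx; apply: contrapT => /eqP qp; apply: nW.
  apply/(bigcup_enumerate (fun p => \bigcup_l enumerate (W p) l) x); exists q.
  by apply/(bigcup_enumerate (W q) x); exists p; rewrite /W (negbTE qp).
(* The sign is reversed: tiling uses x + t, while [translate p] uses x - H^-1 p. *)
pose t0 := invmx H *m intv (- p).
have xt0 : K (x + t0) by rewrite /t0 map_mxN mulmxN.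
rewrite /= (esumID [set t0]); last by move=> t _; rewrite lee_fin.
rewrite setIidr; last by move=> _ ->; exists (- p).
rewrite esum_set1 ?lee_fin// indicE mem_set// esum1 ?adde0//.
move=> _ [[z _ <-] /eqP zt0]; rewrite indicE memNset// => Kz.
move: zt0; rewrite /t0 -(uniq (- z)) ?opprK ?eqxx//.
by rewrite /translate/= map_mxN mulmxN opprK.
Qed.

Lemma character_L2 b : L2 K (character b).
Proof.
split.
  by split; apply: measurable_funTS; apply: measurable_trig;
    [exact: continuous_cos|exact: continuous_sin].
suff -> : sqnorm K (character b) = mu K by exact: gabor_set_finite.
rewrite -(sqnorm1 mK); apply: eq_integral => x _.
by rewrite !normc_sqr /= cos2Dsin2 expr0n addr0 expr1n.
Qed.

Lemma inner_character a b : inner K (character a) (character b) =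
  (\int[mu]_(x in K) cos (2 * pi * dotv (a - b) x))%R +i*
  (\int[mu]_(x in K) sin (2 * pi * dotv (a - b) x))%R.
Proof.
have E x : 2 * pi * dotv (a - b) x = 2 * pi * dotv a x - 2 * pi * dotv b x.
  by rewrite dotvDl dotvNl; ring.
rewrite /inner /cintegral; apply/eqP; rewrite eq_complex /=.
apply/andP; split; apply/eqP; apply: eq_Rintegral => x _.
  by rewrite E cosB; ring.
by rewrite E sinB; ring.
Qed.

(** The spectrum is the fibre of [Lam] above 0. For completeness, f is extended by 0 and
    approximated by Gabor elements; almost everywhere on K only those above 0 survive, and there
    they are c times characters. *)
Lemma gabor_spectral : countable Lam -> spectral K.
Proof.
move=> Lam_countable; have Kfin := gabor_set_finite.
have tr0 : translate 0 = K.
  by apply/seteqP; split=> x; rewrite /translate /= map_mx0 mulmx0 subr0.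
split=> //; first by rewrite Kpos Kfin.
exists [set b | Lam (col_mx 0 b)]; split.
  have /countable_injP[f fi] := Lam_countable.
  apply/countable_injP; exists (fun b => f (col_mx 0 b)) => a b /set_mem La /set_mem Lb E.
  have := fi _ _ (mem_set La) (mem_set Lb) E.
  by move/eq_col_mx => [].
split.
- move=> b _; split; first exact: character_L2.
  rewrite inner_character subrr.
  have E x : dotv (0 : 'cV[R]_n) x = 0.
    by rewrite /dotv big1// => i _; rewrite mxE mul0r.
  under eq_Rintegral do rewrite E mulr0 cos0.
  rewrite Rintegral_cst// mul1r eq_complex /= negb_and gt_eqF//.
  by rewrite fine_gt0// Kpos.
- move=> a b La Lb ab; rewrite inner_character.
  have ww' : col_mx 0 a != col_mx (0 : 'cV[R]_n) b.
    by apply: contraNN ab => /eqP/eq_col_mx[_ ->].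
  have u0 (b' : 'cV[R]_n) : usubmx (col_mx 0 b') = invmx H *m intv 0.
    by rewrite col_mxKu map_mx0 mulmx0.
  have E g : (\int[mu]_(x in K) cos (2 * pi * dotv (a - b) x + g))%R = 0.
    have := tf_shift_orthogonal g La Lb ww' (u0 a) (u0 b).
    by rewrite !col_mxKd -/(translate 0) tr0 setIid.
  have := E 0; under eq_Rintegral do rewrite addr0.
  (* The sine integral is the cosine integral with shift - pi / 2. *)
  move=> ->; have := E (- (pi / 2)).
  by under eq_Rintegral do rewrite cosBpihalf; move=> ->.
- move=> f L2f eps eps0.
  pose f' x := if x \in (K : set (lebesgue_space R n)) then f x else 0.
  have L2f' : L2 setT f'.
    split; first exact: (cmeasurable_patch0 mK L2f.1).
    by rewrite (sqnorm_patch0 _ mK); exact: L2f.2.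
  have [s [a [sL mh lt]]] := gabor_approx L2f' eps0.
  exists [seq dsubmx w | w <- s & usubmx w == 0].
  exists (fun b => a (col_mx 0 b) * c%:C).
  have dsubK (w : 'cV[R]_(n + n)) : usubmx w = 0 -> col_mx 0 (dsubmx w) = w.
    by move=> w0; rewrite -[RHS]vsubmxK w0.
  split.
    move=> b /= /mapP[w]; rewrite mem_filter => /andP[/eqP w0 ws] ->.
    by rewrite dsubK//; exact: sL.
  (* N is the part of K met by other translates, null by packing; outside it the discarded terms
     vanish on K. *)
  pose N := \bigcup_k enumerate (fun p =>
    if p == 0 then set0 else translate 0 `&` translate p) k.
  have mN : lebesgue_measurable N.
    apply: bigcupT_measurable => k; rewrite /enumerate.
    case: (unpickle k) => // p; case: ifP => // _.
    exact: (measurableI _ _ (translate_measurable 0) (translate_measurable p)).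
  have N0 : mu N = 0%E.
    apply/(negligibleP _ mN); apply: negligible_bigcup => k; rewrite /enumerate.
    case: (unpickle k) => [p|]; last exact: negligible_set0.
    case: ifPn => [_|p0]; first exact: negligible_set0.
    apply/(negligibleP _ (measurableI _ _ (translate_measurable 0)
      (translate_measurable p))); apply: translate_null.
    by rewrite eq_sym.
  have mKN : lebesgue_measurable (K `\` N) by exact: (measurableD mK mN).
  have mg : cmeasurable K (fun x =>
      \sum_(b <- [seq dsubmx w | w <- s & usubmx w == 0])
        a (col_mx 0 b) * c%:C * character b x).
    apply: (cmeasurable_sum (e := fun b x => a (col_mx 0 b) * c%:C * character b x)).
    by move=> b _; apply: cmeasurableZ; exact: (character_L2 b).1.
  rewrite (sqnorm_negligible mK mN N0); last first.
    rewrite (_ : (fun _ => _) = fun x => f x + (-1) *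
      \sum_(b <- [seq dsubmx w | w <- s & usubmx w == 0])
        a (col_mx 0 b) * c%:C * character b x).
      by apply: cmeasurableD; [exact: L2f.1|exact: cmeasurableZ].
    by apply/funext => x; rewrite mulN1r.
  apply: le_lt_trans lt; rewrite (@eq_sqnorm _ _ _ _
    (fun x => f' x - \sum_(w <- s) a w * e w x)).
    exact: (le_sqnorm mKN measurableT (@subsetT _ _) mh).
  move=> x [Kx Nx]; rewrite /f' mem_set//; congr (_ - _).
  rewrite big_map big_filter big_mkcond/=; apply: eq_big_seq => w ws.
  case: eqP => [w0|/eqP w0].
    rewrite dsubK// -mulrA; congr (_ * _).
    rewrite /e /tf_shift w0 subr0 /normalized_indicator indicE mem_set// mulr1.
    by rewrite mulrC.
  have [p wp] := Lam_usub (sL _ ws).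
  rewrite tf_shiftE (indic_translate _ wp) indicE memNset ?mulr0 ?mul0r.
    by rewrite (_ : 0 +i* 0 = 0) ?mulr0.
  move=> px; apply: Nx.
  apply/(bigcup_enumerate (fun p => if p == 0 then set0 else translate 0 `&` translate p) x).
  exists p; case: eqP => [p0|_]; last by split => //; rewrite tr0.
  by move: w0; rewrite wp p0 map_mx0 mulmx0 eqxx.
Qed.

End gabor_packing.

(** * The lattice Z^n + C Z^n for symmetric rational C *)

Section rational_lattice.
Context (R : realType) (n : nat).
Local Notation intm M := (map_mx (intr : int -> R) M).

Lemma rational_mx_denominator (C : 'M[R]_n) : rational_mx C ->
  exists (q : int) (P : 'M[int]_n), q != 0 /\ C = q%:~R^-1 *: intm P.
Proof.
move=> [Q ->].
pose q := \prod_(k : 'I_n * 'I_n) denq (Q k.1 k.2).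
have q0 : q != 0 by apply/prodf_neq0 => k _; exact: denq_neq0.
exists q.
exists (\matrix_(i, j) (numq (Q i j) *
  \prod_(k : 'I_n * 'I_n | k != (i, j)) denq (Q k.1 k.2))).
split=> //; apply/matrixP => i j; rewrite !mxE.
have qE : q = denq (Q i j) *
    \prod_(k : 'I_n * 'I_n | k != (i, j)) denq (Q k.1 k.2).
  by rewrite /q (bigD1 (i, j)).
move: q0; rewrite {}qE; set r := \prod_(_ | _) _; rewrite mulf_eq0 negb_or => /andP[d0 r0].
rewrite [LHS]/ratr !rmorphM/= invfM.
have dR : (denq (Q i j))%:~R != 0 :> R by rewrite intr_eq0.
have rR : r%:~R != 0 :> R by rewrite intr_eq0.
by field; rewrite dR rR.
Qed.

(* With C = q^-1 L diag(d) W in Smith normal form, H is diag(q / gcd(d_i, q)) W^-T;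
   symmetry of C is what makes H^-1 Z^n equal to Z^n + C Z^n. *)
Lemma symmetric_rational_lattice (C : 'M[R]_n) : C^T = C -> rational_mx C ->
  exists H : 'M[R]_n, [/\ H \in unitmx,
    forall m k : 'cV[int]_n, exists z : 'cV[int]_n,
      H *m (intm m + C *m intm k) = intm z,
    forall z : 'cV[int]_n, exists m k : 'cV[int]_n,
      invmx H *m intm z = intm m + C *m intm k &
    forall z : 'cV[int]_n, exists m k : 'cV[int]_n,
      H^T *m intm z = intm k /\ intm m + C *m intm k = 0].
Proof.
move=> symC /rational_mx_denominator[q [P [q0 CE]]].
have [L uL [W uW [d _ PE]]] := int_Smith_normal_form P.
pose g i := gcdz (nth 0 d i) q.
pose qi i := (q %/ g i)%Z.
pose ei i := (nth 0 d i %/ g i)%Z.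
have g0 i : g i != 0 by rewrite gcdz_eq0 (negbTE q0) andbF.
have qiE i : q = qi i * g i by rewrite divzK// dvdz_gcdr.
have eiE i : nth 0 d i = ei i * g i by rewrite divzK// dvdz_gcdl.
have qi0 i : qi i != 0.
  by apply: contraNneq q0 => E; rewrite (qiE i) E mul0r.
pose u i := (egcdz (nth 0 d i) q).1; pose v i := (egcdz (nth 0 d i) q).2.
have uvE i : u i * nth 0 d i + v i * q = g i.
  by rewrite /u /v /g; case: egcdzP.
pose dg (a : nat -> int) : 'M[int]_n := diag_mx (\row_i a i).
pose dgR (a : nat -> R) : 'M[R]_n := diag_mx (\row_i a i).
have dgE a : intm (dg a) = dgR (fun i => (a i)%:~R).
  by rewrite map_diag_mx; congr diag_mx; apply/rowP => i; rewrite !mxE.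
have dgM a b : dgR a *m dgR b = dgR (fun i => a i * b i).
  by rewrite mulmx_diag; congr diag_mx; apply/rowP => i; rewrite !mxE.
have dgD a b : dgR a + dgR b = dgR (fun i => a i + b i).
  by apply/matrixP => i j; rewrite !mxE mulrnDl.
have dgZ x a : x *: dgR a = dgR (fun i => x * a i).
  by apply/matrixP => i j; rewrite !mxE mulrnAr.
have dg1 a : (forall i, a i = 1) -> dgR a = 1%:M.
  by move=> a1; apply/matrixP => i j; rewrite !mxE a1.
have eq_dg a b : (forall i, a i = b i) -> dgR a = dgR b.
  by move=> ab; apply/matrixP => i j; rewrite !mxE ab.
have dgT a : (dgR a)^T = dgR a by rewrite tr_diag_mx.
have qR : q%:~R != 0 :> R by rewrite intr_eq0.
have qiR i : (qi i)%:~R != 0 :> R by rewrite intr_eq0.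
have gR i : (g i)%:~R != 0 :> R by rewrite intr_eq0.
have qER i : q%:~R = (qi i)%:~R * (g i)%:~R :> R by rewrite -rmorphM/= -qiE.
have eER i : (nth 0 d i)%:~R = (ei i)%:~R * (g i)%:~R :> R by rewrite -rmorphM/= -eiE.
pose w := intm W; pose w' := intm (invmx W).
pose l := intm L; pose l' := intm (invmx L).
have ww' : w *m w' = 1%:M by rewrite -map_mxM mulmxV// map_mx1.
have w'w : w' *m w = 1%:M by rewrite -map_mxM mulVmx// map_mx1.
have ll' : l *m l' = 1%:M by rewrite -map_mxM mulmxV// map_mx1.
have l'l : l' *m l = 1%:M by rewrite -map_mxM mulVmx// map_mx1.
pose s := dgR (fun i => (nth 0 d i)%:~R).
have CE1 : C = q%:~R^-1 *: (l *m s *m w).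
  rewrite CE PE !map_mxM; congr (_ *: (_ *m _ *m _)).
  by rewrite /s -dgE; congr map_mx; apply/matrixP => i j; rewrite !mxE.
(* Symmetry enters here: the transposed Smith form starts with W^T, which cancels the W^-T in H. *)
have CE2 : C = q%:~R^-1 *: (w^T *m s *m l^T).
  by rewrite -symC CE1 linearZ/= !trmx_mul dgT mulmxA.
pose Q := dgR (fun i => (qi i)%:~R); pose Q' := dgR (fun i => (qi i)%:~R^-1).
have QQ' : Q *m Q' = 1%:M by rewrite dgM dg1// => i; rewrite mulfV.
have Q'Q : Q' *m Q = 1%:M by rewrite dgM dg1// => i; rewrite mulVf.
pose H := Q *m w'^T.
pose H' := w^T *m Q'.
have wT : w'^T *m w^T = 1%:M by rewrite -trmx_mul ww' trmx1.
have wT' : w^T *m w'^T = 1%:M by rewrite -trmx_mul w'w trmx1.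
have HH' : H *m H' = 1%:M.
  by rewrite /H /H' mulmxA -(mulmxA Q) wT mulmx1.
have uH : H \in unitmx by have [] := mulmx1_unit HH'.
have iH : invmx H = H'.
  by rewrite -[RHS](mulKmx uH) HH' mulmx1.
pose E := dgR (fun i => (ei i)%:~R).
have QsE : q%:~R^-1 *: (Q *m s) = E.
  rewrite dgM dgZ; apply: eq_dg => i; rewrite (qER i) eER.
  by field; rewrite qiR gR.
have sQE : q%:~R^-1 *: (s *m Q) = E.
  rewrite dgM dgZ; apply: eq_dg => i; rewrite (qER i) eER.
  by field; rewrite qiR gR.
pose U := dgR (fun i => (u i)%:~R); pose V := dgR (fun i => (v i)%:~R).
(* Bezout's identity u_i d_i + v_i q = g_i divided by q; it splits H^-1 z into an integer vector
   plus C times an integer vector. *)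
have Q'E : Q' = V + q%:~R^-1 *: (s *m U).
  rewrite dgM dgZ dgD; apply: eq_dg => i.
  have : (u i)%:~R * (nth 0 d i)%:~R + (v i)%:~R * q%:~R = (g i)%:~R :> R.
    by rewrite -!rmorphM -rmorphD/= uvE.
  move=> uvR; apply: (mulfI qR); rewrite mulrDr.
  rewrite [q%:~R * (_^-1 * _)]mulrA mulfV// mul1r.
  rewrite [q%:~R * (v i)%:~R]mulrC [_%:~R * (u i)%:~R]mulrC addrC uvR.
  by rewrite (qER i) mulrAC mulfV// mul1r.
exists H; split=> //.
- move=> m k; exists (dg qi *m (invmx W)^T *m m + dg ei *m L^T *m k).
  rewrite map_mxD !map_mxM -!map_trmx !dgE -/Q -/E -/w' -/l -/H mulmxDr; congr (_ + _).
  rewrite CE2 /H -!scalemxAl -!scalemxAr !mulmxA -(mulmxA Q) wT mulmx1.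
  by rewrite -QsE -!scalemxAl.
- move=> z; exists (W^T *m dg v *m z), ((invmx L)^T *m dg u *m z).
  rewrite iH /H' Q'E !map_mxM -!map_trmx !dgE -/V -/U -/w -/l'.
  rewrite mulmxDr mulmxDl; congr (_ + _).
  rewrite CE2 -!scalemxAl -!scalemxAr -!scalemxAl !mulmxA.
  congr (_ *: (_ *m _)); congr (_ *m _).
  by rewrite -[in RHS](mulmxA _ l^T) -trmx_mul l'l trmx1 mulmx1.
(* For k = W^-1 Q z = H^T z the untransposed Smith form gives C k = L E z, an integer vector
   cancelled by m. *)
- move=> z; exists (- (L *m dg ei *m z)), (invmx W *m dg qi *m z).
  rewrite !map_mxM map_mxN !map_mxM !dgE -/Q -/E -/w' -/l; split.
    by rewrite /H trmx_mul trmxK dgT.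
  rewrite CE1 -!scalemxAl !mulmxA -(mulmxA _ w) ww' mulmx1.
  by rewrite -sQE -!scalemxAr -!scalemxAl !mulmxA addNr.
Qed.

End rational_lattice.

(** * From the block matrix to the packing argument *)

Theorem theorem1p6 (R : realType) (d : nat) (hd : (0 < d)%N)
    (K : set 'cV[R]_d) (hKb : bounded_set K) (hKm : lebesgue_measurable K)
    (hKpos : (0 < lebesgue K)%E)
    (A B D : 'M[R]_d)
    (hM : block_mx A D 0 B \in unitmx)
    (hdens : dens (block_mx A D 0 B) = 1)
    (hsym : (invmx A *m D)^T = invmx A *m D)
    (hrat : rational_mx (invmx A *m D))
    (hAB : A^T *m B = 1%:M)
    (hgabor : gabor_orthonormal_basis (normalized_indicator K)
                (lattice (block_mx A D 0 B))) :
  tiles K /\ spectral K.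
Proof.
have [uAT uB] := mulmx1_unit hAB.
have uA : A \in unitmx by rewrite -unitmx_tr.
pose C := invmx A *m D.
have [H [uH Hint Hfib Hdual]] := symmetric_rational_lattice hsym hrat.
pose intv (z : 'cV[int]_d) := map_mx (intr : int -> R) z.
have AD (m k : 'cV[int]_d) :
    A *m intv m + D *m intv k = A *m (intv m + C *m intv k).
  by rewrite mulmxDr /C !mulmxA mulmxV// mul1mx.
have latE (m k : 'cV[int]_d) : block_mx A D 0 B *m map_mx intr (col_mx m k) =
    col_mx (A *m (intv m + C *m intv k)) (B *m intv k).
  by rewrite /intv map_col_mx mul_block_col mul0mx add0r AD.
have AB : (invmx A)^T = B by rewrite trmx_inv -[RHS](mulKmx uAT) hAB mulmx1.
(* Points of [Lam] are (A (m + C k), B k), so their first components form A H^-1 Z^d, and H A^-1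
   takes the role of H above. *)
have uHA : H *m invmx A \in unitmx by rewrite unitmx_mul uH unitmx_inv.
have invHA : invmx (H *m invmx A) = A *m invmx H.
  rewrite -[RHS](mulKmx uHA) (_ : _ *m (A *m _) = 1%:M) ?mulmx1//.
  by rewrite mulmxA -(mulmxA H) mulVmx// mulmx1 mulmxV.
pose Lam := lattice (block_mx A D 0 B).
have Lam0 : Lam 0.
  by exists 0 => //; rewrite map_mx0 mulmx0.
(* Since B = A^-T, the dual vector (H A^-1)^T z is B H^T z = B k, and m + C k = 0 puts (0, B k) in
   [Lam]. *)
have Lam_shift w (z : 'cV[int]_d) : Lam w ->
    Lam (w + col_mx 0 ((H *m invmx A)^T *m intv z)).
  move=> [x _ <-]; have [m [k [kE mk0]]] := Hdual z.
  exists (x + col_mx m k) => //.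
  rewrite map_mxD mulmxDr; congr (_ + _).
  by rewrite latE mk0 mulmx0 trmx_mul AB -mulmxA kE.
have Lam_usub w : Lam w -> exists z : 'cV[int]_d,
    usubmx w = invmx (H *m invmx A) *m intv z.
  move=> [x _ <-]; rewrite -[x]vsubmxK latE col_mxKu.
  have [z zE] := Hint (usubmx x) (dsubmx x); exists z.
  by rewrite invHA /intv -zE -[RHS]mulmxA (mulKmx uH).
have Lam_fiber (z : 'cV[int]_d) : exists b,
    Lam (col_mx (invmx (H *m invmx A) *m intv z) b).
  have [m [k zE]] := Hfib z; exists (B *m intv k); exists (col_mx m k) => //.
  by rewrite latE invHA -[in RHS]mulmxA /intv zE.
split; first exact: (gabor_tiles hKpos hKb uHA Lam0 Lam_shift Lam_usub Lam_fiber hgabor).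
apply: (gabor_spectral hKm hKpos hKb uHA Lam0 Lam_shift Lam_usub Lam_fiber hgabor).
exact: sub_countable (card_image_le _ _) (countableP _).
Qed.
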